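(* Let $J:\mathbb{R}^n\to[0,\infty)$ be convex, lower semicontinuous and absolutely one-homogeneous, and suppose there is a finite set whose convex hull equals $\partial J(0)$. Let $f\in\mathbb{R}^n$. Then: 1. (Gradient flow) There exist finitely many $0=t_0<t_1<\dots<t_K=\infty$ and vectors $p_{GF}(t_{i+1})$ such that the solution of the gradient flow is given by $$u_{GF}(t)=u_{GF}(t_i)-(t-t_i)\,p_{GF}(t_{i+1})\qquad\text{for } t\in[t_i,t_{i+1}],$$ with $p_{GF}(t_{i+1})\in\partial J(u_{GF}(t))$ for $t\in[t_i,t_{i+1}]$; i.e. the dynamics is piecewise linear in $u_{GF}$ and piecewise constant in $p_{GF}$. 2. (Inverse scale space flow) There exist finitely many $0=s_0<s_1<\dots<s_L=\infty$ and vectors $v_{IS}(s_{i+1})$ such that the solution of the inverse scale space flow is given by $$q_{IS}(s)=q_{IS}(s_i)+(s-s_i)\,\big(f-v_{IS}(s_{i+1})\big)\qquad\text{for } s\in[s_i,s_{i+1}],$$ with $q_{IS}(s)\in\partial J(v_{IS}(s_{i+1}))$ for $s\in[s_i,s_{i+1}]$; i.e. the dynamics is piecewise linear in $q_{IS}$ and piecewise constant in $v_{IS}$. 3. (Variational method) There exist finitely many $0=t_0<t_1<\dots<t_L=\infty$ such that $u_{VM}$ is an affine function of $t$ on each interval $[t_i,t_{i+1}]$, and, for $p_{VM}(t)\in\partial J(u_{VM}(t))$ the corresponding subgradient, $q_{VM}(s)=p_{VM}(1/s)$ is an affine function of $s$ on each interval with endpoints $s_i=1/t_i$ and $s_{i+1}=1/t_{i+1}$.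 (The breakpoints and their number may differ between the three items; when an endpoint of an interval is $\infty$, the interval is understood as half-open.)
   Context: Absolutely one-homogeneous means $J(su)=|s|J(u)$ for all $s\in\mathbb{R}$, $u\in\mathbb{R}^n$; $\partial J$ is the convex subdifferential; $\|\cdot\|$ is the Euclidean norm. Gradient flow: $u_{GF}:[0,\infty)\to\mathbb{R}^n$ with $\partial_t u_{GF}(t)=-p_{GF}(t)$, $p_{GF}(t)\in\partial J(u_{GF}(t))$ for a.e. $t$, $u_{GF}(0)=f$. Inverse scale space flow: $\partial_s q_{IS}(s)=f-v_{IS}(s)$, $q_{IS}(s)\in\partial J(v_{IS}(s))$ for a.e. $s$, $q_{IS}(0)=0$. Variational method: for $t>0$, $u_{VM}(t)=\arg\min_u \frac12\|u-f\|^2+tJ(u)$, with $u_{VM}(0)=f$, and $p_{VM}(t)=(f-u_{VM}(t))/t\in\partial J(u_{VM}(t))$ the subgradient in its optimality condition. *)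

(* Defs.v *)
From HB Require Import structures.
From mathcomp Require Import all_boot all_order all_algebra.
From mathcomp Require Import all_classical all_reals all_analysis.

Set Implicit Arguments.
Unset Strict Implicit.
Unset Printing Implicit Defensive.

Import Order.TTheory GRing.Theory Num.Theory.
Import numFieldNormedType.Exports.

Local Open Scope classical_set_scope.
Local Open Scope ring_scope.

Section Convex.
Context {R : realType} {n : nat}.
Implicit Types (J : 'rV[R]_n -> R) (u p : 'rV[R]_n).

Definition dotv u p : R := \sum_(i < n) u ord0 i * p ord0 i.

(* The library norm on ['rV[R]_n] is the maximum norm. *)
Definition enorm u : R := Num.sqrt (dotv u u).

Definition abs_one_homogeneous J := forall (s : R) u, J (s *: u) = `|s| * J u.

Definition subdiff J u : set 'rV[R]_n :=
  [set p | forall v, J u + dotv p (v - u) <= J v].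

Definition convex_hull (A : set 'rV[R]_n) : set 'rV[R]_n :=
  smallest (@convex_set R 'rV[R]_n) A.

Definition argmin (E : 'rV[R]_n -> R) : set 'rV[R]_n :=
  [set u | forall v, E u <= E v].

End Convex.

Section Flows.
Context {R : realType} {n : nat}.
Implicit Types (J : 'rV[R]_n -> R) (f : 'rV[R]_n) (u p q v : R -> 'rV[R]_n).

Local Notation mu := (@lebesgue_measure R).

(* The norm used here is immaterial, all norms on R^n being equivalent. *)
Definition abs_continuous (a b : R) u :=
  forall e : R, 0 < e -> exists2 d : R, 0 < d &
    forall (m : nat) (x y : 'I_m -> R),
      (forall i, a <= x i /\ x i <= y i /\ y i <= b) ->
      trivIset setT (fun i => `]x i, y i[%classic) ->
      \sum_(i < m) (y i - x i) < d ->
      \sum_(i < m) `|u (y i) - u (x i)| < e.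

(* Local absolute continuity is what makes an equation for the derivative
   almost everywhere, together with an initial value, meaningful. *)
Definition loc_abs_continuous u :=
  forall T : R, 0 <= T -> abs_continuous 0 T u.

Definition gradient_flow J f u p :=
  [/\ loc_abs_continuous u, u 0 = f &
      {ae mu, forall t : R, 0 < t ->
         is_derive t (1 : R) u (- p t) /\ subdiff J (u t) (p t)}].

Definition inverse_scale_space_flow J f q v :=
  [/\ loc_abs_continuous q, q 0 = 0 &
      {ae mu, forall s : R, 0 < s ->
         is_derive s (1 : R) q (f - v s) /\ subdiff J (v s) (q s)}].

Definition variational_method J f u :=
  u 0 = f /\
  forall t : R, 0 < t ->
    argmin (fun w => 2^-1 * enorm (w - f) ^+ 2 + t * J w) = [set u t].

Definition pVM f u (t : R) : 'rV[R]_n := t^-1 *: (f - u t).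

Definition qVM f u (s : R) : 'rV[R]_n := pVM f u s^-1.

Definition eq_on_halfline u v := forall t : R, 0 <= t -> u t = v t.

Definition ae_eq_on_halfline u v :=
  {ae mu, forall t : R, 0 <= t -> u t = v t}.

Definition affine_on (A : set R) u :=
  exists a b : 'rV[R]_n, forall t, A t -> u t = a + t *: b.

(* 0 = t_0 < t_1 < ... < t_K = +oo; in particular K > 0 and t_i is finite
   for i < K. *)
Definition breakpoints (K : nat) (t : nat -> \bar R) :=
  [/\ t 0%N = 0%E, t K = +oo%E & forall i, (i < K)%N -> (t i < t i.+1)%E].

(* The set of real numbers between two extended reals: half-open when an
   endpoint is infinite. *)
Definition between (a b : \bar R) : set R :=
  [set t : R | (a <= t%:E)%E /\ (t%:E <= b)%E].

End Flows.

(* Main.v *)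
Require Import Defs.
From HB Require Import structures.
From mathcomp Require Import all_boot all_order all_algebra.
From mathcomp Require Import all_classical all_reals all_analysis.
From mathcomp Require Import ring lra.

(** Both flows are descents [x' \in - A x] along a monotone operator [A]: for
the gradient flow [A] is the subdifferential of [J], and for the inverse scale
space flow, written in terms of the dual variable [q] alone, [A q] is the set
of the [v - f] with [q] a subgradient of [J] at [v].  Three further properties
are shared by the two operators: the resolvent equation [A (x - t a) a] is
solvable in [a] for each [t > 0] (minimize [|z - w|^2 / 2 + J z]), the set of
points at which a given [a] is a value is closed and convex, and [A x] takes
only finitely many values as [x] varies.  Finiteness is the only place where
the polyhedrality of the dual ball is used: a subdifferential is determined by
the generators of the dual ball that it contains, and [A q] in the second case
by the subdifferentials that contain [q].

Finiteness and closedness give a neighbourhood of [x] on which the values of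
[A] are subsets of [A x] ([near_sub_values]).  A resolvent step of small length
[t] from [x] therefore produces a velocity [a] that lies in [A x] and in
[A (x - t a)], hence in [A] along the whole segment; monotonicity makes it the
element of least norm of [A x] ([initial_step]).  One follows [a] as long as it
stays a value of [A].  If this stops, then the least value at the end point is
strictly shorter than [a] ([maximal_step]).  Hence [A x] is never the same at two
breakpoints [x], and the motion ends with a ray after finitely many segments
([exists_piecewise_linear_solution]).

Two solutions approach each other, since the squared distance has a derivative
that is nonpositive almost everywhere and is absolutely continuous
([abs_continuous_nonincreasing], [evolution_unique]).

For the variational method, [u t = f - t p t] with [p t] a subgradient at [u t],
a resolvent step from [f].  For each of the finitely many subdifferentials [X],
the times [t] such that [p t] is in [X] and [X] is included in the
subdifferential at [u t] form a convex set on which [u] is affine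
([face_times_convex]).  These sets cover the positive times, and their end
points serve as breakpoints ([finite_affine_pieces]).  Finally
[q s = s (f - u (1 / s))] is affine in [s] where [u] is affine in [t]. *)

Set Implicit Arguments.
Unset Strict Implicit.
Unset Printing Implicit Defensive.

Import Order.TTheory GRing.Theory Num.Theory.
Import numFieldNormedType.Exports.

Local Open Scope classical_set_scope.
Local Open Scope ring_scope.

(** * Euclidean inner product and maximum norm *)

Section Dot.
Context {R : realType} {n : nat}.
Implicit Types (u v w : 'rV[R]_n).

Lemma dotvC u v : dotv u v = dotv v u.
Proof. by apply: eq_bigr => i _; rewrite mulrC. Qed.

Lemma dotvDl u v w : dotv (u + v) w = dotv u w + dotv v w.
Proof. by rewrite -big_split; apply: eq_bigr => i _; rewrite mxE mulrDl. Qed.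

Lemma dotvZl c u w : dotv (c *: u) w = c * dotv u w.
Proof. by rewrite /dotv mulr_sumr; apply: eq_bigr => i _; rewrite mxE mulrA. Qed.

Lemma dotvNl u w : dotv (- u) w = - dotv u w.
Proof. by rewrite -scaleN1r dotvZl mulN1r. Qed.

Lemma dotvDr u v w : dotv w (u + v) = dotv w u + dotv w v.
Proof. by rewrite dotvC dotvDl !(dotvC w). Qed.

Lemma dotvZr c u w : dotv w (c *: u) = c * dotv w u.
Proof. by rewrite dotvC dotvZl (dotvC w). Qed.

Lemma dotvNr u w : dotv w (- u) = - dotv w u.
Proof. by rewrite dotvC dotvNl (dotvC w). Qed.

Definition dotvE := (dotvDl, dotvDr, dotvNl, dotvNr, dotvZl, dotvZr).

Lemma dot0v w : dotv 0 w = 0.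
Proof. by rewrite -(scale0r 0) dotvZl mul0r. Qed.

Lemma dotv0 w : dotv w 0 = 0.
Proof. by rewrite dotvC dot0v. Qed.

Lemma dotv_ge0 u : 0 <= dotv u u.
Proof. by apply: sumr_ge0 => i _; rewrite -expr2 sqr_ge0. Qed.

Lemma dotv_le0 u : dotv u u <= 0 -> u = 0.
Proof.
move=> u0; have /eqP : dotv u u = 0 by apply/eqP; rewrite eq_le u0 dotv_ge0.
rewrite psumr_eq0 => [/allP u00|i _]; last by rewrite -expr2 sqr_ge0.
apply/rowP => i; rewrite mxE.
by have := u00 i; rewrite mem_index_enum => /(_ isT); rewrite -expr2 sqrf_eq0 => /eqP.
Qed.

Lemma enorm_sqr u : enorm u ^+ 2 = dotv u u.
Proof. by rewrite sqr_sqrtr ?dotv_ge0. Qed.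

Lemma le_coord_norm u i : `|u ord0 i| <= `|u|.
Proof. by rewrite [leRHS]/Num.Def.normr/= mx_normrE; exact: (le_bigmax _ _ (ord0, i)). Qed.

Lemma norm_le u c : 0 <= c -> (forall i, `|u ord0 i| <= c) -> `|u| <= c.
Proof.
move=> c0 uc; rewrite [leLHS]/Num.Def.normr/= mx_normrE.
by apply: bigmax_le => // -[i j] _ /=; rewrite ord1.
Qed.

Lemma norm_sqr_le_dotv u : `|u| ^+ 2 <= dotv u u.
Proof.
rewrite -enorm_sqr lerXn2r ?nnegrE ?sqrtr_ge0//; apply: norm_le => [|i].
  exact: sqrtr_ge0.
rewrite -sqrtr_sqr ler_sqrt ?dotv_ge0// /dotv (bigD1 i)//= -expr2 lerDl.
by apply: sumr_ge0 => j _; rewrite -expr2 sqr_ge0.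
Qed.

Lemma norm_le_dotv u c : 0 <= c -> dotv u u <= c ^+ 2 -> `|u| <= c.
Proof.
move=> c0 uc; rewrite -(@ler_pXn2r _ 2)// ?nnegrE//.
exact: le_trans (norm_sqr_le_dotv u) uc.
Qed.

Lemma dotv_continuous : continuous (fun u : 'rV[R]_n => dotv u u).
Proof.
pose F i (u : 'rV[R]_n) : R := u ord0 i * u ord0 i.
have cF i : continuous (F i).
  by move=> u; apply: continuousM; exact: coord_continuous.
exact: (@continuous_big R _ +%R 0 xpredT (@add_continuous R)
  'rV[R]_n (index_enum 'I_n) F (fun i _ => cF i)).
Qed.

Lemma dotvr_continuous v : continuous (fun u : 'rV[R]_n => dotv u v).
Proof.
pose F i (u : 'rV[R]_n) : R := u ord0 i * v ord0 i.
have cF i : continuous (F i).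
  by move=> u; apply: continuousM; [exact: coord_continuous|exact: cst_continuous].
exact: (@continuous_big R _ +%R 0 xpredT (@add_continuous R)
  'rV[R]_n (index_enum 'I_n) F (fun i _ => cF i)).
Qed.

End Dot.

(** * Polygonal solutions of monotone inclusions *)

Section Breakpoints.
Context {R : realType}.
Implicit Types (t : nat -> \bar R) (s : R).

Lemma breakpoints_ge0 K t i : breakpoints K t -> (i <= K)%N -> (0 <= t i)%E.
Proof.
move=> [t0 _ tS]; elim: i => [_|i IH iK]; first by rewrite t0.
exact: le_trans (IH (ltnW iK)) (ltW (tS i iK)).
Qed.

Lemma breakpoints_fin_num K t i : breakpoints K t -> (i < K)%N ->
  t i \is a fin_num.
Proof.
move=> bt iK; rewrite ge0_fin_numE ?(breakpoints_ge0 bt (ltnW iK))//.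
by have [_ _ /(_ _ iK) /lt_le_trans] := bt; apply; rewrite leey.
Qed.

(** The piece is found from the first breakpoint that is not below [s]. *)
Lemma breakpoints_cover K t s : breakpoints K t -> 0 <= s ->
  exists2 i, (i < K)%N & between (t i) (t i.+1) s.
Proof.
move=> bt s0; have [t0 tK tS] := bt.
have exi : exists i, (s%:E <= t i)%E by exists K; rewrite tK leey.
have [[|i] si mini] := ex_minnP exi.
  exists 0%N; first by case: K tK {bt tS} => //; rewrite t0.
  split; first by rewrite t0 lee_fin.
  have /tS/ltW : (0 < K)%N by case: K tK {bt tS} => //; rewrite t0.
  exact: le_trans.
exists i; first by apply: mini; rewrite tK leey.
split=> //; rewrite leNgt; apply/negP => /ltW /mini; by rewrite ltnn.
Qed.

End Breakpoints.

Section PiecewiseLinear.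
Context {R : realType} {n : nat}.
Local Notation V := 'rV[R]_n.
Implicit Types (x y a b : V) (A : V -> set V) (u p : R -> V).

Lemma norm_line_sub x a s r :
  `|(x - s *: a) - (x - r *: a)| = `|a| * `|s - r|.
Proof.
rewrite (_ : _ - _ = (r - s) *: a); first by rewrite normrZ mulrC distrC.
by apply/rowP => i; rewrite !mxE; ring.
Qed.

Definition piecewise_linear_solution A x u K (t : nat -> \bar R) (pt : nat -> V) :=
  [/\ u 0 = x, breakpoints K t &
   forall i, (i < K)%N -> forall tau, between (t i) (t i.+1) tau ->
     u tau = u (fine (t i)) - (tau - fine (t i)) *: pt i.+1 /\
     A (u tau) (pt i.+1)].

(** One regularity notion for the polygonal solutions, from which absolute
continuity follows, and for the variational path, where it extends affinity
from an open interval to its end points. *)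
Definition lipschitz_halfline u := exists2 c, 0 <= c &
  forall s r, 0 <= s -> 0 <= r -> `|u s - u r| <= c * `|s - r|.

Lemma ray_solution A x a : (forall s, 0 <= s -> A (x - s *: a) a) ->
  exists u K t pt, piecewise_linear_solution A x u K t pt /\ lipschitz_halfline u.
Proof.
move=> Aa; exists (fun s => x - s *: a), 1%N,
  (fun i => if i is 0%N then 0%E else +oo%E), (fun=> a); split; [split|].
- by rewrite scale0r subr0.
- by split=> // -[].
- move=> [|//] _ tau [/=]; rewrite lee_fin => tau0 _.
  by rewrite scale0r !subr0; split=> //; exact: Aa.
- exists `|a| => // s r _ _.
  by rewrite norm_line_sub.
Qed.

(** The induction step on the number of pieces: a segment followed by a solution
issued from its end point. *)
Lemma concat_solution A x a t1 u1 K t pt : 0 < t1 ->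
  (forall s, 0 <= s <= t1 -> A (x - s *: a) a) ->
  piecewise_linear_solution A (x - t1 *: a) u1 K t pt -> lipschitz_halfline u1 ->
  exists u K t pt, piecewise_linear_solution A x u K t pt /\ lipschitz_halfline u.
Proof.
move=> t10 Aa [u10 bt ut] [c c0 uc].
have [t0 tK tS] := bt.
pose u s := if s <= t1 then x - s *: a else u1 (s - t1).
have uE s : t1 <= s -> u s = u1 (s - t1).
  rewrite le_eqVlt /u => /predU1P[<-|]; first by rewrite lexx subrr u10.
  by rewrite ltNge => /negbTE ->.
exists u, K.+1, (fun i => if i is j.+1 then (t1%:E + t j)%E else 0%E),
  (fun i => if i is j.+2 then pt j.+1 else a); split; [split|].
- by rewrite /u ltW// scale0r subr0.
- split=> //; first by rewrite tK addey.
  move=> [_|i]; first by rewrite t0 adde0 lte_fin.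
  by rewrite ltnS => iK; rewrite lteD2lE//; exact: tS.
- move=> [_|i].
    move=> tau [/=]; rewrite t0 adde0 !lee_fin => tau0 tau1.
    by rewrite subr0 /u tau1 ltW// scale0r subr0; split=> //; apply: Aa; rewrite tau0.
  rewrite ltnS => iK tau [/=].
  have tif := breakpoints_fin_num bt iK.
  have ti0 : 0 <= fine (t i) by rewrite fine_ge0// (breakpoints_ge0 bt (ltnW iK)).
  rewrite -(fineK tif) -EFinD lee_fin => tau1 tau2.
  have [|e Ae] := ut i iK (tau - t1).
    split; first by rewrite -(fineK tif) lee_fin; lra.
    by rewrite EFinB leeBlDl.
  rewrite [fine _]/= !uE; [split=> //|lra..].
  rewrite e /=; congr (u1 _ - _ *: _); lra.
- have ua s r : 0 <= s -> s <= r -> `|u s - u r| <= (`|a| + c) * `|s - r|.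
    move=> s0 sr; have [rt|tr] := leP r t1.
      rewrite /u rt (le_trans sr rt).
      by rewrite norm_line_sub ler_wpM2r// lerDl.
    have [st|ts] := leP s t1.
      rewrite (uE r) ?(ltW tr)// /u st.
      have h1 := uc 0 (r - t1) (lexx _) (ltac:(lra)).
      have h2 : `|(x - s *: a) - (x - t1 *: a)| = `|a| * (t1 - s).
        by rewrite norm_line_sub distrC ger0_norm ?subr_ge0.
      rewrite -[_ - u1 _](subrKA (x - t1 *: a)).
      apply: le_trans (ler_normD _ _) _; rewrite h2 -u10.
      move: h1; rewrite sub0r normrN (ger0_norm (_ : 0 <= r - t1)) ?subr_ge0 ?(ltW tr)//.
      rewrite ler0_norm; last lra.
      have := normr_ge0 a; nra.
    rewrite !uE ?(ltW tr) ?(ltW ts)//.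
    have -> : s - r = (s - t1) - (r - t1) by lra.
    apply: le_trans (uc _ _ _ _) _; [lra..|].
    by rewrite ler_wpM2r// lerDr.
  exists (`|a| + c); first by rewrite addr_ge0.
  move=> s r s0 r0; have [sr|/ltW rs] := leP s r; first exact: ua.
  by rewrite distrC (distrC s); exact: ua.
Qed.

Lemma count_lt (T : eqType) (P Q : pred T) (s : seq T) (z : T) :
  z \in s -> ~~ P z -> Q z -> (forall z, P z -> Q z) -> (count P s < count Q s)%N.
Proof.
move=> + Pz Qz PQ; elim: s => // y s IH; rewrite inE => /predU1P[<-|/IH] /=.
  by rewrite (negbTE Pz) Qz add0n add1n ltnS; exact: sub_count.
rewrite -(ltn_add2l (Q y)); apply: leq_ltn_trans; rewrite leq_add2r.
by case: (P y) (PQ y) => // ->.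
Qed.

End PiecewiseLinear.

Lemma near_seq (T : Type) (Y : eqType) (F : set_system T) (P : Y -> T -> Prop)
    (s : seq Y) : Filter F -> (forall y, \forall x \near F, P y x) ->
  \forall x \near F, forall y, y \in s -> P y x.
Proof.
move=> FF FP; elim: s => [|y s IH]; first by apply: nearW => x y; rewrite in_nil.
near=> x => z; rewrite inE => /predU1P[->|]; first by near: x; exact: FP.
by move: z; near: x.
Unshelve. all: by end_near. Qed.

Section PolyhedralOperator.
Context {R : realType} {n : nat}.
Local Notation V := 'rV[R]_n.
Implicit Types (x y a b : V).
Context (A : V -> set V).
Context (A_monotone : forall x y a b, A x a -> A y b ->
  0 <= dotv (a - b) (x - y)).
Context (A_resolvent : forall x t, 0 < t -> exists a, A (x - t *: a) a).
Context (A_finite : finite_set (range A)).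
Context (A_closed : forall a, closed [set x | A x a]).
Context (A_convex : forall a x y c, 0 <= c <= 1 -> A x a -> A y a ->
  A (c *: x + (1 - c) *: y) a).

(** A value [X] of [A] that is not included in [A x] has an element [a] which is
not in [A x]; the points where [a] is a value form a closed set that misses [x],
so [X] is not a value near [x].  As there are finitely many values [X], one
neighbourhood works for all of them. *)
Lemma near_sub_values x : \forall y \near x, A y `<=` A x.
Proof.
have /finite_seqP[F FE] := A_finite.
suff H : forall X : set V, \forall y \near x, A y = X -> X `<=` A x.
  have := @near_seq V _ (nbhs x) (fun X y => A y = X -> X `<=` A x) F
    (nbhs_filter x) H.
  apply: (@filterS _ _ (nbhs_filter x)) => y /(_ (A y)).
  by apply=> //; have : range A (A y) by []; rewrite FE.
move=> X; have [XA|/existsNP[a /not_implyP[Xa Ax]]] := pselect (X `<=` A x).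
  by apply: (@filterE _ _ (nbhs_filter x)) => y _.
have : open_nbhs x (~` [set y | A y a]).
  by split => //; rewrite openC; exact: A_closed.
move/open_nbhs_nbhs; apply: (@filterS _ _ (nbhs_filter x)) => y Ay AX.
by case: Ay => /=; rewrite AX.
Qed.

(** The variational inequality that characterizes the element of least norm of a
convex set.  In any set, it determines [a], and no element is shorter than [a]
([least_value_gt]); monotonicity delivers it in this form. *)
Definition least_value x a := A x a /\ forall b, A x b -> dotv a a <= dotv b a.

Lemma least_value_resolvent x a t b :
  0 < t -> A (x - t *: a) a -> A x b -> dotv a a <= dotv b a.
Proof.
move=> t0 Aa Ab; have := A_monotone Aa Ab.
have -> : x - t *: a - x = - (t *: a) by rewrite addrC addKr.
rewrite dotvNr dotvZr -mulrN pmulr_rge0// dotvDl dotvNl; lra.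
Qed.

Lemma segment_values x a t s : A x a -> A (x - t *: a) a -> 0 <= s <= t ->
  A (x - s *: a) a.
Proof.
move=> Ax At /andP[s0 st]; have [t0|t0] := leP t 0.
  by rewrite (_ : s = 0) ?scale0r ?subr0//; lra.
rewrite (_ : x - _ = (1 - s / t) *: x + (1 - (1 - s / t)) *: (x - t *: a)).
  apply: A_convex => //; rewrite subr_ge0 ler_pdivrMr// mul1r st/=.
  by rewrite gerBl divr_ge0// ltW.
by apply/rowP => i; rewrite !mxE; field; lra.
Qed.

(** The resolvent [a] is at most as long as any element of [A x], by monotonicity,
so the end point [x - t a] is close to [x] for small [t], and its values are
values at [x]. *)
Lemma initial_step x : A x !=set0 -> exists a t, [/\ 0 < t, least_value x a &
  forall s, 0 <= s <= t -> A (x - s *: a) a].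
Proof.
move=> [a0 Aa0]; have /nbhs_ballP[d /= d0 dA] := near_sub_values x.
pose t := d / (enorm a0 + 1).
have e0 : 0 <= enorm a0 by exact: sqrtr_ge0.
have t0 : 0 < t by apply: divr_gt0 => //; lra.
have [a Aa] := A_resolvent x t0.
have a_le : `|a| <= enorm a0.
  apply: norm_le_dotv => //; rewrite enorm_sqr.
  have := least_value_resolvent t0 Aa Aa0; have := dotv_ge0 (a - a0).
  by rewrite !dotvE (dotvC a a0); lra.
have Axa : A x a.
  apply: (dA (x - t *: a)) => //; rewrite -ball_normE/= opprB addrC subrK.
  rewrite normrZ gtr0_norm// /t mulrAC ltr_pdivrMr; last lra.
  by rewrite ltr_pM2l//; lra.
exists a, t; split => //; last by move=> s; exact: segment_values.
by split => // b; exact: least_value_resolvent Aa.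
Qed.

Lemma least_value_gt x a b : A x a -> least_value x b ->
  a = b \/ dotv b b < dotv a a.
Proof.
move=> Aa [_ /(_ _ Aa) ba]; have [ab|] := leP (dotv a a) (dotv b b); [left|by right].
apply/eqP; rewrite -subr_eq0; apply/eqP/dotv_le0.
by rewrite !dotvE (dotvC b a); lra.
Qed.

(** Let [t] be the supremum of the admissible step lengths, if they are bounded.
Then [a] is a value at [x - t a] since these lengths form a closed set.  It cannot be the least value at [x - t a], because [initial_step] would
allow for a longer step; so the least value there is strictly shorter. *)
Lemma maximal_step x a : least_value x a ->
  (forall s, 0 <= s -> A (x - s *: a) a) \/
  exists t, [/\ 0 < t, forall s, 0 <= s <= t -> A (x - s *: a) a &
    exists2 b, least_value (x - t *: a) b & dotv b b < dotv a a].
Proof.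
move=> xa.
pose G := [set t | 0 <= t /\ A (x - t *: a) a].
have [[M GM]|noub] := pselect (has_ubound G); [right|left]; last first.
  move=> s s0; have [t [[t0 At] st]] : exists t, G t /\ s <= t.
    apply/not_existsP => h; apply: noub; exists s => t Gt.
    by have := h t => /not_andP[//|/negP]; rewrite -ltNge => /ltW.
  by apply: (segment_values xa.1 At); rewrite s0.
have G0 : G 0 by split=> //; rewrite scale0r subr0; exact: xa.1.
have supG : has_sup G by split; [exists 0|exists M].
have clG : closed G.
  apply: closedI; first exact: closed_ge.
  apply: (@closed_comp _ _ (fun t : R => x - t *: a) [set y | A y a]) => [t _|].
    apply: (@continuousB R V _ (cst x) (fun t : R => t *: a)).
      exact: cst_continuous.
    exact: scalel_continuous.
  exact: A_closed.
pose t := sup G.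
have Gt : G t by apply: clG; apply: closure_sup; [exists 0|exists M].
have [b [e [e0 xb eb]]] : exists b e, [/\ 0 < e, least_value (x - t *: a) b &
    forall s, 0 <= s <= e -> A (x - t *: a - s *: b) b].
  by apply: initial_step; exists a; exact: Gt.2.
have not_more s : 0 < s -> ~ A (x - (t + s) *: a) a.
  move=> s0 As; have : G (t + s) by split => //; rewrite addr_ge0 ?(ltW s0)// Gt.1.
  by move/(ub_le_sup supG.2); rewrite -/t; lra.
have a_neq : a <> b.
  move=> ab; apply: (not_more e) => //; rewrite scalerDl opprD addrA.
  by rewrite {2 3}ab; apply: eb; rewrite lexx ltW.
exists t; split.
- rewrite lt_neqAle Gt.1 andbT; apply/eqP => t0; apply: a_neq.
  have [a' [e' [e'0 xa' ea']]] := initial_step (ex_intro _ a xa.1).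
  have aa' : a = a'.
    have [//|h] := least_value_gt xa.1 xa'.
    by have [//|h'] := least_value_gt xa'.1 xa; have := lt_trans h h'; rewrite ltxx.
  case: (not_more e') => //; rewrite -t0 add0r {1 2}aa'.
  by apply: ea'; rewrite lexx ltW.
- by move=> s; exact: segment_values xa.1 Gt.2.
- by exists b => //; have [] := least_value_gt Gt.2 xb.
Qed.

(** Induction on the number of values of [A] that contain an element shorter than
the current velocity.  After a maximal step this number drops: the value at the
end point is counted before the step but not after it, when the velocity is the
shortest element of that very value. *)
Theorem exists_piecewise_linear_solution x : A x !=set0 ->
  exists (u : R -> V) K t pt,
    piecewise_linear_solution A x u K t pt /\ lipschitz_halfline u.
Proof.
have /finite_seqP[F FE] := A_finite.
have AF y : A y \in F by have : range A (A y) by []; rewrite FE.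
pose shorter a := fun X : set V => `[< exists2 b, X b & dotv b b < dotv a a >].
suff main N : forall y a, least_value y a -> (count (shorter a) F < N)%N ->
    exists (u : R -> V) K t pt,
    piecewise_linear_solution A y u K t pt /\ lipschitz_halfline u.
  move=> Ax; have [a [_ [_ xa _]]] := initial_step Ax.
  exact: main xa (ltnSn _).
elim: N => // N IH y a ya; rewrite ltnS => cN.
have [Aa|[t1 [t10 Aa [b yb ba]]]] := maximal_step ya.
  exact: ray_solution Aa.
have [|u [K [t [pt [ut uc]]]]] := IH _ _ yb; last exact: concat_solution ut uc.
apply: leq_trans cN; apply: (count_lt (AF (y - t1 *: a))).
- apply/asboolPn => -[b' Ab' b'b].
  by have [e|] := least_value_gt Ab' yb; [move: b'b; rewrite e ltxx|
    move=> /(lt_trans b'b); rewrite ltxx].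
- by apply/asboolP; exists b => //; exact: yb.1.
- move=> X /asboolP[b' Xb' b'b]; apply/asboolP; exists b' => //.
  exact: lt_trans b'b ba.
Qed.

End PolyhedralOperator.

(** * Absolutely continuous functions with nonpositive derivative almost everywhere *)

Section Monotonicity.
Context {R : realType} {n : nat}.
Local Notation V := 'rV[R]_n.
Local Notation mu := (@lebesgue_measure R).
Implicit Types (u w : R -> V) (g : R -> R).

(** The supremum of the points that are reached is reached, from the left, and it
can be passed, to the right, unless it is [b]. *)
Lemma continuous_induction (P : R -> R -> Prop) (G : R -> Prop) (b : R) :
  0 <= b -> G 0 ->
  (forall x y, 0 <= x -> x <= y -> y <= b -> G x -> P x y -> G y) ->
  (forall z, 0 <= z -> z <= b -> exists2 d, 0 < d &
    forall x y, z - d < x -> x <= z -> z <= y -> y < z + d -> P x y) ->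
  G b.
Proof.
move=> b0 G0 GP loc.
pose H := [set t | [/\ 0 <= t, t <= b & G t]].
have H0 : H 0 by split.
have supH : has_sup H by split; [exists 0|exists b => t []].
pose T := sup H.
have T0 : 0 <= T by exact: ub_le_sup supH.2 _ H0.
have Tb : T <= b by apply: sup_le_ub; [exists 0|move=> t []].
have [d d0 dP] := loc T T0 Tb.
have [x [x0 xb Gx] xT] := sup_adherent d0 supH.
have xleT : x <= T by exact: ub_le_sup supH.2 _ (And3 x0 xb Gx).
have GT : G T by apply: (GP x T) => //; apply: dP => //; lra.
have [bT|Tltb] := leP b T; first by rewrite (_ : b = T)//; lra.
pose y := Num.min b (T + d / 2).
have Ty : T < y by rewrite lt_min Tltb/=; lra.
have yd : y <= T + d / 2 by rewrite ge_min lexx orbT.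
have yb : y <= b by rewrite ge_min lexx.
have Gy : G y by apply: (GP T y) => //; [lra|apply: dP => //; lra].
have : H y by split=> //; lra.
by move/(ub_le_sup supH.2); rewrite -/T leNgt Ty.
Qed.

(** Lists of intervals that grow by adding at the head an interval on the right
of the others, as they appear in the continuous induction. *)
Definition stacked (s : seq (R * R)) := pairwise (fun p q => q.2 <= p.1) s.

Lemma abs_continuous_seq a b u : abs_continuous a b u ->
  forall e, 0 < e -> exists2 d, 0 < d & forall s : seq (R * R), stacked s ->
    (forall p, p \in s -> [/\ a <= p.1, p.1 <= p.2 & p.2 <= b]) ->
    \sum_(p <- s) (p.2 - p.1) < d -> \sum_(p <- s) `|u p.2 - u p.1| < e.
Proof.
move=> acu e /acu[d d0 du]; exists d => // s /(pairwiseP (0, 0)) sd sab.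
rewrite !(big_nth (0, 0)) !big_mkord; apply: du.
  by move=> i; have [] := sab _ (mem_nth (0, 0) (ltn_ord i)).
have main (i j : 'I_(size s)) z : (i < j)%N ->
    `](nth (0, 0) s i).1, (nth (0, 0) s i).2[%classic z ->
    `](nth (0, 0) s j).1, (nth (0, 0) s j).2[%classic z -> False.
  move=> ij; rewrite /= !in_itv/= => /andP[+ _] /andP[_ +].
  have := sd i j (ltn_ord i) (ltn_ord j) ij; lra.
move=> i j _ _ [z [zi zj]]; apply/val_inj; case: (ltngtP i j) => // ij.
  by case: (main _ _ _ ij zi zj).
by case: (main _ _ _ ij zj zi).
Qed.

Lemma negligible_open_cover (N : set R) d : mu.-negligible N -> 0 < d ->
  exists U, [/\ open U, N `<=` U & (mu U < d%:E)%E].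
Proof.
move=> [A [mA A0 NA]] d0.
have [U [oU AU Ud]] : exists U : set R,
    [/\ open U, A `<=` U & (mu (U `\` A) < d%:E)%E].
  by apply: lebesgue_regularity_outer => //; rewrite [X in (X < _)%E]A0.
exists U; split=> //; first exact: subset_trans AU.
rewrite (_ : U = (U `\` A) `|` A); last by rewrite setUC setDUK.
rewrite measureU0//; apply: measurableD => //.
exact: measurable_realfun.open_measurable.
Qed.

(** Bounding the total length by the measure of [U] up to the current point makes
the bound for disjoint intervals additive, one interval at a time. *)
Lemma total_length_step (U : set R) (l x y : R) : open U ->
  0 <= x -> x <= y -> `[x, y] `<=` U ->
  (l%:E <= mu (U `&` `[0%R, x]))%E -> ((y - x + l)%:E <= mu (U `&` `[0%R, y]))%E.
Proof.
move=> oU x0 xy xyU lU; have mU : measurable U by exact: measurable_realfun.open_measurable.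
have mxy : mu `]x, y]%classic = (y - x)%:E.
  rewrite lebesgue_measure_itv/= lte_fin; have [//|yx] := ltP x y.
  by rewrite (_ : y = x) ?subrr//; lra.
rewrite EFinD -mxy; apply: le_trans (leeD2l _ lU) _.
rewrite -measureU//=; last 2 first.
- by apply: measurableI => //; exact: measurable_itv.
- by apply/seteqP; split=> z //= []; rewrite !in_itv/= => + [_]; lra.
apply: le_measure; rewrite ?inE.
- by apply: measurableU => //; apply: measurableI.
- by apply: measurableI.
move=> z /= [|[Uz]]; rewrite !in_itv/= => /andP[h1 h2]; split=> //; last lra.
  by apply: xyU; rewrite /= in_itv/=; lra.
lra.
Qed.

Definition local_slope_le g t e := exists2 d, 0 < d &
  forall x y, t - d < x -> x <= t -> t <= y -> y < t + d ->
    g y - g x <= e * (y - x).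

(** The exceptional null set is covered by an open set [U] of small measure.
Starting from 0, one moves right either along an interval on which the mean
slope is at most [e], or along an interval included in [U].  The increments of
the second kind are small in total, by absolute continuity.  One of
the two kinds is available on both sides of each point, so that [b] is reached.  The majorant [w]
allows for [g] a function of an absolutely continuous curve. *)
Lemma abs_continuous_nonincreasing (w : R -> V) g (b K : R) :
  0 <= b -> abs_continuous 0 b w -> 0 <= K ->
  (forall x y, 0 <= x -> x <= y -> y <= b -> `|g y - g x| <= K * `|w y - w x|) ->
  {ae mu, forall t, 0 < t -> forall e, 0 < e -> local_slope_le g t e} ->
  g b <= g 0.
Proof.
move=> b0 acw K0 gw aeg.
apply/ler_addgt0Pr => e0 e00.
(* the moves of the first kind add up to [e * b], the others to [K * e] *)
pose e := e0 / (b + K + 1).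
have e_gt0 : 0 < e by apply: divr_gt0 => //; lra.
have [d d0 dw] := abs_continuous_seq acw e_gt0.
(* the almost everywhere hypothesis says nothing about the point 0 *)
pose N := ~` [set t | 0 < t -> forall e, 0 < e -> local_slope_le g t e] `|` [set 0].
have negN : mu.-negligible N.
  apply: negligibleU => //; exists [set 0]; split=> //.
  exact: lebesgue_measure_set1.
have [U [oU NU Ud]] := negligible_open_cover negN d0.
(* [s] lists the intervals included in [U] that have been used *)
pose reach t := exists s : seq (R * R), [/\ stacked s,
  forall p, p \in s -> [/\ 0 <= p.1, p.1 <= p.2 & p.2 <= t],
  ((\sum_(p <- s) (p.2 - p.1))%:E <= mu (U `&` `[0%R, t]))%E &
  g t - g 0 <= e * t + \sum_(p <- s) `|g p.2 - g p.1|].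
have [s [s_st sb sU gb]] : reach b.
  apply: (@continuous_induction (fun x y => g y - g x <= e * (y - x) \/
      `[x, y] `<=` U) reach) => //.
  - exists [::]; split => //; first by rewrite big_nil; exact: measure_ge0.
    by rewrite big_nil; lra.
  - move=> x y x0 xy yb [s [s_st sx sU gx]] [slope|xyU].
      exists s; split => //.
      + by move=> p /sx[? ? ?]; split=> //; lra.
      + apply: le_trans sU _; apply: le_measure; rewrite ?inE.
        * by apply: measurableI => //; exact: measurable_realfun.open_measurable.
        * by apply: measurableI => //; exact: measurable_realfun.open_measurable.
        * apply: setIS => z /=; rewrite !in_itv/=; lra.
      + lra.
    exists ((x, y) :: s); split.
    + rewrite /stacked/= -/(stacked s) s_st andbT; apply/allP => p /sx[]//.
    + by move=> p; rewrite inE => /predU1P[->//=|/sx[? ? ?]]; split=> //; lra.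
    + by rewrite big_cons/=; exact: total_length_step.
    + rewrite big_cons/=; have := ler_norm (g y - g x).
      have : 0 <= e * (y - x) by rewrite mulr_ge0 ?subr_ge0// ltW.
      lra.
  - move=> z z0 zb; have [Nz|Nz] := pselect (N z).
      have := oU z (NU z Nz) => /nbhs_ballP[r /= r0 rU]; exists r => // x y zx xz zy yz.
      right => t /=; rewrite in_itv/= => /andP[xt ty]; apply: rU.
      rewrite -ball_normE/= ltr_norml; lra.
    have z_gt0 : 0 < z.
      rewrite lt_neqAle z0 andbT; apply/eqP => z00; apply: Nz; right.
      by rewrite /= z00.
    have [r r0 rP] : local_slope_le g z e.
      have [//|h] := pselect (local_slope_le g z e); case: Nz; left => /= /(_ z_gt0).
      by move/(_ e e_gt0).
    by exists r => // x y zx xz zy yz; left; exact: rP.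
have sd : \sum_(p <- s) (p.2 - p.1) < d.
  rewrite -lte_fin; apply: le_lt_trans Ud; apply: le_trans sU _.
  apply: le_measure; rewrite ?inE.
  - by apply: measurableI => //; exact: measurable_realfun.open_measurable.
  - exact: measurable_realfun.open_measurable.
  - exact: subIsetl.
have := dw s s_st sb sd.
have : \sum_(p <- s) `|g p.2 - g p.1| <= K * \sum_(p <- s) `|w p.2 - w p.1|.
  rewrite mulr_sumr big_seq [leRHS]big_seq; apply: ler_sum => p /sb[? ? ?].
  exact: gw.
have : e * (b + K + 1) = e0 by rewrite /e divfK//; lra.
nra.
Qed.

End Monotonicity.

(** * Solutions almost everywhere, and their uniqueness *)

Section Evolution.
Context {R : realType} {n : nat}.
Local Notation V := 'rV[R]_n.
Local Notation mu := (@lebesgue_measure R).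
Implicit Types (u w p : R -> V) (A : V -> set V) (x y : V).

Let ae_filter : Filter (almost_everywhere mu) := ae_filter_ringOfSetsType mu.

Definition evolution A x u p :=
  [/\ loc_abs_continuous u, u 0 = x &
      {ae mu, forall t : R, 0 < t ->
         is_derive t (1 : R) u (- p t) /\ A (u t) (p t)}].

Lemma lipschitz_loc_abs_continuous u : lipschitz_halfline u -> loc_abs_continuous u.
Proof.
move=> [c c0 uc] T T0 e e0; exists (e / (c + 1)) => [|m x y xy _ lt].
  by apply: divr_gt0 => //; lra.
apply: (@le_lt_trans _ _ (c * \sum_(i < m) (y i - x i))).
  rewrite mulr_sumr; apply: ler_sum => i _; have [x0 [xy' _]] := xy i.
  have := uc (y i) (x i) (le_trans x0 xy') x0.
  by rewrite (ger0_norm (_ : 0 <= y i - x i)) ?subr_ge0.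
have s0 : 0 <= \sum_(i < m) (y i - x i).
  by apply: sumr_ge0 => i _; have [_ [? _]] := xy i; rewrite subr_ge0.
move: lt; rewrite ltr_pdivlMr; last lra.
lra.
Qed.

Lemma near_between (a b : \bar R) (t : R) : (a < t%:E)%E -> (t%:E < b)%E ->
  \forall s \near t, between a b s.
Proof.
move=> at_ tb.
have h1 : \forall s \near t, (a <= s%:E)%E.
  case: a at_ => [r| |] //=; rewrite ?lte_fin => rt.
    by near=> s; rewrite lee_fin ltW//; near: s; exact: lt_nbhsr.
  by apply: (@filterE _ _ (nbhs_filter t)) => s; rewrite leNye.
have h2 : \forall s \near t, (s%:E <= b)%E.
  case: b tb => [r| |] //=; rewrite ?lte_fin => rt.
    by near=> s; rewrite lee_fin ltW//; near: s; exact: lt_nbhsl.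
  by apply: (@filterE _ _ (nbhs_filter t)) => s; rewrite leey.
by near=> s; split; near: s.
Unshelve. all: by end_near. Qed.

Lemma is_derive_line (x a : V) (t0 t : R) :
  is_derive t (1 : R) (fun s : R => x - (s - t0) *: a) (- a).
Proof.
have H : h^-1 *: (x - (h *: 1 + t - t0) *: a - (x - (t - t0) *: a)) @[h --> 0^'] --> - a.
  apply: cvg_near_cst; apply: filterS (nbhs_dnbhs_neq 0) => h h0.
  rewrite (_ : x - _ - _ = - (h *: a)); last first.
    by apply/rowP => i; rewrite !mxE /GRing.scale/=; ring.
  by rewrite scalerN scalerA mulVf// scale1r.
by split; [apply/cvg_ex; exists (- a)|exact: cvg_lim].
Qed.

Lemma piecewise_linear_derive A x u K t pt i tau :
  piecewise_linear_solution A x u K t pt -> (i < K)%N ->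
  (t i < tau%:E)%E -> (tau%:E < t i.+1)%E -> is_derive tau (1 : R) u (- pt i.+1).
Proof.
move=> [_ _ ut] iK t1 t2.
apply: near_eq_is_derive (is_derive_line (u (fine (t i))) (pt i.+1) (fine (t i)) tau).
by have := near_between t1 t2; apply: (@filterS _ _ (nbhs_filter tau)) => s /(ut i iK)[].
Qed.

Lemma ae_not_breakpoint K (t : nat -> \bar R) :
  {ae mu, forall tau : R, forall i, (i < K)%N -> tau != fine (t i)}.
Proof.
exists [set fine (t i) | i in `I_K].
have fin : finite_set [set fine (t i) | i in `I_K] by apply: finite_image; exact: finite_II.
split.
- apply: countable_measurable => //; exact: finite_set_countable.
- by apply: countable_lebesgue_measure0; exact: finite_set_countable.
- move=> tau /= /existsNP[i /not_implyP[iK /negP]]; rewrite negbK => /eqP ->.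
  by exists i.
Qed.

Lemma between_strict K (t : nat -> \bar R) i (tau : R) : breakpoints K t -> (i < K)%N ->
  (forall j, (j < K)%N -> tau != fine (t j)) -> between (t i) (t i.+1) tau ->
  (t i < tau%:E)%E /\ (tau%:E < t i.+1)%E.
Proof.
move=> bt iK ntau [h1 h2]; have [_ tK _] := bt; split; rewrite lt_neqAle ?h1 ?h2 andbT.
  apply/eqP => e; have := ntau i iK; by rewrite e/= eqxx.
apply/eqP => e; have [iK'|iK'] := ltnP i.+1 K.
  by have := ntau _ iK'; rewrite -e/= eqxx.
by have : i.+1 = K by [apply/eqP; rewrite eqn_leq iK iK'] => iE; rewrite iE tK in e.
Qed.

Lemma piecewise_linear_velocity A x u K t pt i :
  piecewise_linear_solution A x u K t pt -> (i < K)%N ->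
  {ae mu, forall tau : R, between (t i) (t i.+1) tau -> - 'D_1 u tau = pt i.+1}.
Proof.
move=> ut iK; have := ae_not_breakpoint K t; apply: (@filterS _ _ ae_filter) => tau ntau tbt.
have [_ bt _] := ut; have [t1 t2] := between_strict bt iK ntau tbt.
have [_ ->] := piecewise_linear_derive ut iK t1 t2.
by rewrite opprK.
Qed.

Lemma piecewise_linear_evolution A x u K t pt :
  piecewise_linear_solution A x u K t pt -> lipschitz_halfline u ->
  evolution A x u (fun s => - 'D_1 u s).
Proof.
move=> ut uc; have [u0 bt uA] := ut; split => //.
  exact: lipschitz_loc_abs_continuous.
have := ae_not_breakpoint K t; apply: (@filterS _ _ ae_filter) => tau ntau tau0.
have [i iK tbt] := breakpoints_cover bt (ltW tau0).
have [t1 t2] := between_strict bt iK ntau tbt.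
have ud := piecewise_linear_derive ut iK t1 t2.
have -> : - 'D_1 u tau = pt i.+1 by have [_ ->] := ud; rewrite opprK.
by split => //; exact: (uA i iK tau tbt).2.
Qed.

Lemma abs_continuousB a b u w : abs_continuous a b u -> abs_continuous a b w ->
  abs_continuous a b (fun t => u t - w t).
Proof.
move=> au aw e e0; have e20 : 0 < e / 2 by lra.
have [d1 d10 ud] := au _ e20; have [d2 d20 wd] := aw _ e20.
exists (Num.min d1 d2) => [|m x y xy tr]; first by rewrite lt_min d10.
rewrite lt_min => /andP[lt1 lt2].
have := ud m x y xy tr lt1; have := wd m x y xy tr lt2.
suff : \sum_(i < m) `|u (y i) - w (y i) - (u (x i) - w (x i))| <=
   \sum_(i < m) `|u (y i) - u (x i)| + \sum_(i < m) `|w (y i) - w (x i)| by lra.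
rewrite -big_split/=; apply: ler_sum => i _.
rewrite (_ : _ - _ = (u (y i) - u (x i)) - (w (y i) - w (x i))).
  exact: ler_normB.
by apply/rowP => j; rewrite !mxE; ring.
Qed.

(** Steps of length [d / 2] change [u] by less than 1. *)
Lemma abs_continuous_bounded b u : 0 <= b -> abs_continuous 0 b u ->
  exists2 M, 0 <= M & forall s, 0 <= s -> s <= b -> `|u s| <= M.
Proof.
move=> b0 acu; have [d d0 ud] := abs_continuous_seq acu ltr01.
have d2 : 0 < d / 2 by lra.
have small (x y : R) : 0 <= x -> x <= y -> y <= b -> y - x < d -> `|u y - u x| < 1.
  move=> x0 xy yb yx; have := ud [:: (x, y)]; rewrite !big_seq1/=; apply=> //.
  by move=> p; rewrite inE => /eqP ->.
have step (k : nat) s : 0 <= s -> s <= b -> s <= k%:R * (d / 2) ->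
    `|u s| <= `|u 0| + k%:R.
  elim: k s => [|k IH] s s0 sb sk.
    by rewrite (_ : s = 0) ?addr0//; move: sk; rewrite mul0r; lra.
  have [h|h] := leP s (k%:R * (d / 2)).
    by apply: le_trans (IH _ s0 sb h) _; rewrite lerD2l ler_nat.
  have k0 : 0 <= k%:R * (d / 2) by rewrite mulr_ge0//; lra.
  have := IH _ k0 (ltac:(lra)) (lexx _).
  have := small _ _ k0 (ltW h) sb; rewrite -natr1 in sk *.
  move=> /(_ ltac:(lra)) h1 h2.
  rewrite -(subrK (u (k%:R * (d / 2))) (u s)).
  apply: le_trans (ler_normD _ _) _; lra.
pose k := Num.bound (b / (d / 2)).
exists (`|u 0| + k%:R) => [|s s0 sb]; first by rewrite addr_ge0.
apply: step => //; apply: le_trans sb _; rewrite -ler_pdivrMr//.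
by apply/ltW/archi_boundP; rewrite divr_ge0// ltW.
Qed.

Lemma dotv_le_norm (a b : V) : `|dotv a b| <= n%:R * (`|a| * `|b|).
Proof.
apply: le_trans (ler_norm_sum _ _ _) _.
rewrite -[X in X%:R]card_ord -sum1_card natr_sum mulr_suml; apply: ler_sum => i _.
by rewrite mul1r normrM ler_pM// le_coord_norm.
Qed.

Lemma is_derive_local_slope (g : R -> R) (t c e : R) :
  is_derive t (1 : R) g c -> c <= 0 -> 0 < e -> local_slope_le g t e.
Proof.
move=> [gd gc] c0 e0; have {gd}: h^-1 *: ((g \o shift t) (h *: 1) - g t) @[h --> 0^'] --> c by rewrite -gc.
move=> /cvgrPdist_lt/(_ e e0)/nbhs_ballP[d /= d0 dP]; exists d => //.
have slope h : `|h| < d -> h != 0 -> h^-1 * (g (h + t) - g t) < e.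
  move=> hd h0; have := dP h; rewrite -ball_normE/= sub0r normrN => /(_ hd h0).
  by rewrite ltr_norml /= [h *: 1]mulr1 => /andP[+ _]; rewrite [_ *: _]/GRing.scale/=; lra.
move=> x y tx xt ty yt.
have h1 : g y - g t <= e * (y - t).
  have [yt0|yt0] := eqVneq y t; first by rewrite yt0 !subrr mulr0.
  have y0 : 0 < y - t by rewrite subr_gt0 lt_neqAle eq_sym yt0.
  have := slope (y - t); rewrite subrK gtr0_norm// gt_eqF// => /(_ ltac:(lra) isT).
  by rewrite ltr_pdivrMl// => /ltW; rewrite mulrC.
have h2 : g t - g x <= e * (t - x).
  have [yt0|yt0] := eqVneq x t; first by rewrite yt0 !subrr mulr0.
  have y0 : 0 < t - x by rewrite subr_gt0 lt_neqAle yt0.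
  have := slope (x - t); rewrite subrK distrC gtr0_norm// subr_eq0 yt0 => /(_ ltac:(lra) isT).
  rewrite -[x - t]opprB invrN mulNr -mulrN opprB.
  by rewrite ltr_pdivrMl// => /ltW; rewrite mulrC.
lra.
Qed.

Lemma is_derive_dotv w (t : R) (dw : V) : is_derive t (1 : R) w dw ->
  is_derive t (1 : R) (fun s => dotv (w s) (w s)) (2 * dotv (w t) dw).
Proof.
move=> [wd <-].
have wi i : is_derive t (1 : R) (fun s => w s ord0 i) ('D_1 w t ord0 i).
  split; first exact: (derivable_mxP _ _ _).1 wd ord0 i.
  by rewrite derive_mx// mxE.
have := is_derive_sum (fun i => is_deriveM (wi i) (wi i)).
rewrite (_ : \sum_(i < n) _ = (fun s => dotv (w s) (w s))); last first.
  by apply/funext => s; rewrite fct_sumE.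
rewrite (_ : \sum_(i < n) _ = 2 * dotv (w t) ('D_1 w t))//.
rewrite /dotv mulr_sumr; apply: eq_bigr => i _.
rewrite /GRing.scale/=; ring.
Qed.

(** With [w] the difference of the solutions, the derivative of [dotv w w] is
[- 2 dotv (p' - p) w], which is nonpositive by monotonicity.  The velocities
agree since the derivatives do. *)
Lemma evolution_unique A x u p u' p' :
  (forall x y a b, A x a -> A y b -> 0 <= dotv (a - b) (x - y)) ->
  evolution A x u p -> evolution A x u' p' ->
  eq_on_halfline u' u /\ ae_eq_on_halfline p' p.
Proof.
move=> A_monotone [acu u0 aeu] [acu' u'0 aeu'].
have uu' : eq_on_halfline u' u.
  move=> T T0; pose w s := u' s - u s.
  suff /dotv_le0/eqP : dotv (w T) (w T) <= 0 by rewrite subr_eq0 => /eqP.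
  have acw : abs_continuous 0 T w by apply: abs_continuousB; [exact: acu'|exact: acu].
  have [M M0 wM] := abs_continuous_bounded T0 acw.
  have w0 : dotv (w 0) (w 0) = 0 by rewrite /w u0 u'0 subrr dot0v.
  rewrite -w0.
  apply: (@abs_continuous_nonincreasing _ _ w (fun s => dotv (w s) (w s)) T
    (n%:R * (2 * M))) => //.
  - by rewrite !mulr_ge0.
  - move=> r s r0 rs sT.
    have -> : dotv (w s) (w s) - dotv (w r) (w r) = dotv (w s + w r) (w s - w r).
      by move: (w s) (w r) => a b; rewrite !dotvE (dotvC b a); ring.
    apply: le_trans (dotv_le_norm _ _) _; rewrite -mulrA ler_wpM2l// ler_wpM2r//.
    have := wM r r0 (le_trans rs sT); have := wM s (le_trans r0 rs) sT.
    have := ler_normD (w s) (w r); lra.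
  - move: aeu aeu'; apply: (@filterS2 _ _ ae_filter) => s hu hu' s0 e e0.
    have [du Au] := hu s0; have [du' Au'] := hu' s0.
    have dw : is_derive s (1 : R) w (- p' s - - p s) by exact: is_deriveB.
    apply: (is_derive_local_slope (is_derive_dotv dw)) => //.
    have := A_monotone _ _ _ _ Au' Au.
    by rewrite -/(w s) !(dotvE, dotvC (w s)); lra.
split => //.
suff : {ae mu, forall t : R, t != 0 -> 0 <= t -> p' t = p t}.
  have ae0 : {ae mu, forall t : R, t != 0}.
    exists [set 0]; split=> //; first exact: lebesgue_measure_set1.
    by move=> t /= /negP; rewrite negbK => /eqP.
  by move: ae0; apply: (@filterS2 _ _ ae_filter) => t t0 /(_ t0).
move: aeu aeu'; apply: (@filterS2 _ _ ae_filter) => t hu hu' t0 t_ge0.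
have t_gt0 : 0 < t by rewrite lt_neqAle eq_sym t0.
have [du _] := hu t_gt0; have [du' _] := hu' t_gt0.
have : is_derive t (1 : R) u' (- p t).
  apply: near_eq_is_derive du; near=> s; apply/esym/uu'/ltW.
  by near: s; exact: lt_nbhsr.
by move=> [_ e]; case: du' => _; rewrite e => /oppr_inj.
Unshelve. all: by end_near. Qed.

End Evolution.

(** * Functions that are affine on each set of a finite convex cover *)

Section FiniteAffinePieces.
Context {R : realType} {n : nat}.
Local Notation V := 'rV[R]_n.
Implicit Types (u : R -> V) (I : set R).

(** [I] is convex and [u] commutes with convex combinations of points of [I]. *)
Definition affine_on_convex I u := forall s t c, I s -> I t -> 0 <= c <= 1 ->
  I (c * s + (1 - c) * t) /\
  u (c * s + (1 - c) * t) = c *: u s + (1 - c) *: u t.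

(** One passes from [I] to its complement only across [inf I] or [sup I].  When
[I] is unbounded on one side, the default value of the corresponding bound does
no harm. *)
Lemma convex_set_ends I u : affine_on_convex I u -> exists e : seq R, forall x y,
  I x -> ~ I y -> exists2 z, z \in e & Num.min x y <= z <= Num.max x y.
Proof.
move=> Iu; exists [:: inf I; sup I] => x y Ix Iy.
have conv s t r : I s -> I t -> s <= r -> r <= t -> s < t -> I r.
  move=> Is It sr rt st; pose c := (t - r) / (t - s).
  have c01 : 0 <= c <= 1.
    rewrite /c divr_ge0 ?ler_pdivrMr; lra.
  have [+ _] := Iu s t c Is It c01.
  by rewrite (_ : _ + _ = r)// /c; field; lra.
have [xy|yx|xy] := ltgtP x y; last by rewrite xy in Ix.
- have ubI : ubound I y.
    move=> z Iz; rewrite leNgt; apply/negP => yz; apply: Iy.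
    by apply: (conv x z) => //; lra.
  exists (sup I); first by rewrite !inE eqxx orbT.
  rewrite ub_le_sup//=; last by exists y.
  by apply: sup_le_ub => //; exists x.
- have lbI : lbound I y.
    move=> z Iz; rewrite leNgt; apply/negP => yz; apply: Iy.
    by apply: (conv z x) => //; lra.
  exists (inf I); first by rewrite !inE eqxx.
  rewrite ge_inf//= ?andbT; last by exists y.
  by apply: lb_le_inf => //; exists x.
Qed.

Lemma three_point I u x y z : affine_on_convex I u -> I x -> I z -> x <= y -> y <= z ->
  x < z -> (z - x) *: u y = (z - y) *: u x + (y - x) *: u z.
Proof.
move=> Iu Ix Iz xy yz xz; pose c := (z - y) / (z - x).
have c01 : 0 <= c <= 1 by rewrite /c divr_ge0 ?ler_pdivrMr; lra.
have [_] := Iu x z c Ix Iz c01.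
rewrite (_ : c * x + _ = y) => [->|]; last by rewrite /c; field; lra.
by apply/rowP => i; rewrite !mxE /c; field; lra.
Qed.

Lemma affine_on_convex_affine I u x0 x1 : affine_on_convex I u -> I x0 -> I x1 -> x0 < x1 ->
  exists a b, forall y, I y -> u y = a + y *: b.
Proof.
move=> Iu I0 I1 x01; pose b := (x1 - x0)^-1 *: (u x1 - u x0).
exists (u x0 - x0 *: b), b => y Iy; apply/rowP => i.
have d0 : x1 - x0 != 0 by lra.
apply: (mulfI d0).
suff : (x1 - x0) * u y ord0 i =
    (x1 - x0) * u x0 ord0 i + (y - x0) * (u x1 ord0 i - u x0 ord0 i).
  by move=> ->; rewrite !mxE; field.
have [yx|yx] := ltP y x0.
  have /rowP/(_ i) := three_point Iu Iy I1 (ltW yx) (ltW x01) (lt_trans yx x01).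
  by rewrite !mxE; lra.
have [xy|xy] := leP y x1.
  have /rowP/(_ i) := three_point Iu I0 I1 yx xy x01.
  by rewrite !mxE; lra.
have /rowP/(_ i) := three_point Iu I0 Iy (ltW x01) (ltW xy) (lt_trans x01 xy).
by rewrite !mxE; lra.
Qed.

(** The breakpoints are the positive elements of [E] in increasing order, between
0 and infinity; infinity is the default value of [nth]. *)
Lemma breakpoints_avoiding (E : seq R) : exists K (t : nat -> \bar R),
  breakpoints K t /\ forall i z, (i < K)%N -> z \in E ->
    ~ ((t i < z%:E)%E /\ (z%:E < t i.+1)%E).
Proof.
pose s := 0 :: sort <=%R (undup [seq z <- E | 0 < z]).
have s_sorted : sorted <%R s.
  rewrite /s /= path_min_sorted; last first.
    by apply/allP => z; rewrite mem_sort mem_undup mem_filter => /andP[].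
  by rewrite sort_lt_sorted undup_uniq.
pose t i := nth +oo%E [seq z%:E | z <- s] i.
have tE i : (i < size s)%N -> t i = (nth 0 s i)%:E.
  by move=> si; rewrite /t (nth_map 0).
have toy i : (size s <= i)%N -> t i = +oo%E.
  by move=> si; rewrite /t nth_default// size_map.
exists (size s), t; split.
  split; [by rewrite tE|by rewrite toy|move=> i si; rewrite tE//].
  have [si'|si'] := ltnP i.+1 (size s); last by rewrite toy// ltry.
  by rewrite tE// lte_fin (lt_sorted_ltn_nth _ s_sorted).
move=> i z si zE [tz zt].
have z0 : 0 < z.
  rewrite -lte_fin; apply: le_lt_trans tz; rewrite tE// lee_fin.
  case: i si {zt} => [|i] si //=.
  have : nth 0 s i.+1 \in behead s by apply: mem_nth.
  by rewrite mem_sort mem_undup mem_filter => /andP[/ltW].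
have zs : z \in s.
  by rewrite inE mem_sort mem_undup mem_filter z0 zE orbT.
have := zs; rewrite -index_mem => ks; move: tz zt; rewrite tE// -(nth_index 0 zs).
rewrite lte_fin (lt_sorted_ltn_nth _ s_sorted) ?inE// => ik.
have [si'|si'] := ltnP i.+1 (size s).
  by rewrite tE// lte_fin (lt_sorted_ltn_nth _ s_sorted) ?inE// ltnS leqNgt ik.
by have := leq_trans ks si'; rewrite ltnS leqNgt ik.
Qed.

(** A point of the closed interval is moved slightly towards the interior point
[x0]. *)
Lemma affine_on_closure u (al be : \bar R) x0 a b : lipschitz_halfline u ->
  (0 <= al)%E -> (al < x0%:E)%E -> (x0%:E < be)%E ->
  (forall y, (al < y%:E)%E -> (y%:E < be)%E -> u y = a + y *: b) ->
  forall y, between al be y -> u y = a + y *: b.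
Proof.
move=> [c c0 uc] al0 x0l x0r uab y [yl yr].
have y0 : 0 <= y by rewrite -lee_fin (le_trans al0).
have x00 : 0 <= x0 by rewrite -lee_fin (le_trans al0)// ltW.
pose D := (c + `|b|) * `|y - x0|.
have D0 : 0 <= D by rewrite mulr_ge0// addr_ge0.
apply/eqP; rewrite -subr_eq0 -normr_le0; apply/ler_addgt0Pr => e e0; rewrite add0r.
pose r := Num.min 1 (e / (D + 1)).
have r0 : 0 < r by rewrite lt_min ltr01 divr_gt0//; lra.
have r1 : r <= 1 by rewrite ge_min lexx.
have rD : r * D <= e.
  have : r <= e / (D + 1) by rewrite ge_min lexx orbT.
  by rewrite ler_pdivlMr; nra.
(* an interior point at distance [r * `|y - x0|] from [y] *)
pose z := y + r * (x0 - y).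
have zl : (al < z%:E)%E.
  case: al al0 x0l yl {uab} => [al| |]//=; rewrite !(lte_fin, lee_fin) => _ h1 h2.
  rewrite /z; have [->|] := eqVneq r 1; first lra.
  by rewrite neq_lt => /orP[r1'|]; [nra|lra].
have zr : (z%:E < be)%E.
  case: be x0r yr {uab} => [be| |]//=; rewrite ?ltry// !(lte_fin, lee_fin) => h1 h2.
  rewrite /z; have [->|] := eqVneq r 1; first lra.
  by rewrite neq_lt => /orP[r1'|]; [nra|lra].
have z0 : 0 <= z by rewrite -lee_fin (le_trans al0)// ltW.
have := uab z zl zr => uz.
rewrite (_ : u y - _ = (u y - u z) - (y - z) *: b); last first.
  by rewrite uz; apply/rowP => i; rewrite !mxE; ring.
apply: le_trans (ler_normB _ _) _; rewrite normrZ.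
have yz : `|y - z| = r * `|y - x0|.
  have -> : y - z = r * (y - x0) by rewrite /z; ring.
  by rewrite normrM gtr0_norm.
apply: le_trans (lerD (uc y z y0 z0) (lexx _)) _.
by rewrite yz; apply: le_trans rD; rewrite /D; lra.
Qed.

(** An open interval that contains no end point of the sets of the cover lies in
each set of the cover that it meets. *)
Lemma finite_affine_pieces u (Is : seq (set R)) : lipschitz_halfline u ->
  (forall I, I \in Is -> affine_on_convex I u) ->
  (forall t, 0 < t -> exists2 I, I \in Is & I t) ->
  exists K t, breakpoints K t /\
    forall i, (i < K)%N -> affine_on (between (t i) (t i.+1)) u.
Proof.
move=> uc Iu Icov.
have [E EP] : exists E : seq R, forall I, I \in Is -> forall x y,
    I x -> ~ I y -> exists2 z, z \in E & Num.min x y <= z <= Num.max x y.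
  elim: Is Iu {Icov} => [|I Is IH] Iu; first by exists [::].
  have [E EP] : exists E : seq R, forall I, I \in Is -> forall x y,
      I x -> ~ I y -> exists2 z, z \in E & Num.min x y <= z <= Num.max x y.
    by apply: IH => J JIs; apply: Iu; rewrite inE JIs orbT.
  have [e eP] := convex_set_ends (Iu I (mem_head _ _)).
  exists (e ++ E) => J; rewrite inE => /predU1P[->|JIs] x y Jx Jy.
    by have [z ze ?] := eP x y Jx Jy; exists z; rewrite // mem_cat ze.
  by have [z ze ?] := EP J JIs x y Jx Jy; exists z; rewrite // mem_cat ze orbT.
have [K [t [bt tE]]] := breakpoints_avoiding E.
exists K, t; split=> // i iK.
have ti0 := breakpoints_ge0 bt (ltnW iK); have tif := breakpoints_fin_num bt iK.
have [x0 [x1 [x01 tx0 x1t]]] : exists x0 x1,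
    [/\ x0 < x1, (t i < x0%:E)%E & (x1%:E < t i.+1)%E].
  have [_ _ /(_ i iK)] := bt; rewrite -(fineK tif); set al := fine (t i).
  case: (t i.+1) => [be| |] //; rewrite ?lte_fin => abe.
    exists (al + (be - al) / 3), (al + (be - al) / 2).
    by rewrite !lte_fin; split; lra.
  exists (al + 1), (al + 2); rewrite !lte_fin ltry; split=> //; clear; lra.
have x0_gt0 : 0 < x0 by rewrite -lte_fin (le_lt_trans ti0).
have [I IIs Ix0] := Icov x0 x0_gt0.
have x0t : (x0%:E < t i.+1)%E by apply: lt_trans x1t; rewrite lte_fin.
have tx1 : (t i < x1%:E)%E by apply: lt_trans tx0 _; rewrite lte_fin.
have gapI y : (t i < y%:E)%E -> (y%:E < t i.+1)%E -> I y.
  move=> ty yt; have [//|Iy] := pselect (I y).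
  have [z zE /andP[z1 z2]] := EP I IIs x0 y Ix0 Iy.
  case: (tE i z iK zE); split.
    by apply: lt_le_trans (_ : (Num.min x0 y)%:E <= _)%E; rewrite ?lee_fin// /Num.min; case: ifP.
  by apply: le_lt_trans (_ : _ <= (Num.max x0 y)%:E)%E _; rewrite ?lee_fin// /Num.max; case: ifP.
have [a [b ab]] := affine_on_convex_affine (Iu I IIs) Ix0 (gapI x1 tx1 x1t) x01.
exists a, b; apply: affine_on_closure tx0 x0t _ => // y ty yt.
exact/ab/gapI.
Qed.

End FiniteAffinePieces.

(** * Subdifferentials of absolutely one-homogeneous convex functions *)

Lemma closed_sublevel (R : realType) (T : topologicalType) (f : T -> R) c :
  continuous f -> closed [set x | f x <= c].
Proof.
move=> cf; apply: (@closed_comp _ _ f [set y | y <= c]) => [x _|].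
  exact: cf.
exact: closed_le.
Qed.

Lemma subdiff_monotone (R : realType) n (J : 'rV[R]_n -> R) u v p q :
  subdiff J u p -> subdiff J v q -> 0 <= dotv (p - q) (u - v).
Proof. by move=> /(_ v) + /(_ u); rewrite !dotvE; lra. Qed.

Lemma closed_subdiff (R : realType) n (J : 'rV[R]_n -> R) u :
  closed (subdiff J u).
Proof.
rewrite (_ : subdiff J u =
  \bigcap_v [set p | dotv p (v - u) <= J v - J u]).
  apply: closed_bigI => v _; apply: closed_sublevel.
  exact: dotvr_continuous.
by apply/seteqP; split => p Jp v => [_|]; have := Jp v; rewrite /= lerBrDl //; exact.
Qed.

Section OneHomogeneous.
Context {R : realType} {n : nat} (J : 'rV[R]_n -> R).
Implicit Types (u v w p q : 'rV[R]_n).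
Context (J_convex : convex_function (setT : set (convex_lmodType 'rV[R]_n)) J).
Context (J_hom : abs_one_homogeneous J).

Lemma hom0 : J 0 = 0.
Proof. by rewrite -(scale0r 0) J_hom normr0 mul0r. Qed.

Lemma homZ c u : 0 <= c -> J (c *: u) = c * J u.
Proof. by move=> c0; rewrite J_hom ger0_norm. Qed.

Lemma homN u : J (- u) = J u.
Proof. by rewrite -scaleN1r J_hom normrN1 mul1r. Qed.

Lemma subadditive u v : J (u + v) <= J u + J v.
Proof.
have h0 : (0 : R) <= 2^-1 by lra.
have h1 : (2^-1 : R) <= 1 by lra.
have := J_convex (Itv01 h0 h1) (in_setT u) (in_setT v).
rewrite /conv/= /conv/= /unstable.onem (_ : 1 - 2^-1 = 2^-1 :> R); last by lra.
by rewrite -scalerDr homZ// -mulrDr ler_pM2l.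
Qed.

(** By sublinearity, [J u] is at most the sum of the [|u i| J (e i)], so the sum of
the [J (e i)] is a Lipschitz constant of [J] for the maximum norm; it also bounds
the subgradients. *)
Definition lip_const : R := \sum_(i < n) J (delta_mx ord0 i).

Context (J_ge0 : forall u, 0 <= J u).

Lemma lip_const_ge0 : 0 <= lip_const.
Proof. by apply: sumr_ge0. Qed.

Lemma le_lip_const u : J u <= lip_const * `|u|.
Proof.
rewrite [in leLHS](row_sum_delta u) mulr_suml.
apply: (@le_trans _ _ (\sum_(i < n) J (u ord0 i *: delta_mx ord0 i))).
  elim/big_ind2 : _ => [|x x' y y' xx' yy'|i _]; rewrite ?hom0//.
  by rewrite (le_trans (subadditive _ _))// lerD.
by apply: ler_sum => i _; rewrite J_hom mulrC ler_wpM2l// le_coord_norm.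
Qed.

Lemma lipschitz_hom u v : `|J u - J v| <= lip_const * `|u - v|.
Proof.
rewrite ler_norml; apply/andP; split.
  rewrite -(opprB v u) normrN; have := subadditive u (v - u); rewrite subrKC.
  by have := le_lip_const (v - u); lra.
have := subadditive v (u - v); rewrite subrKC.
by have := le_lip_const (u - v); lra.
Qed.

Lemma continuous_hom : continuous J.
Proof.
move=> u; apply/(@cvgrPdist_le _ _ _ (nbhs u)) => e e0.
have c0 : 0 < lip_const + 1 by have := lip_const_ge0; lra.
apply: filterS (nbhsx_ballx u (e / (lip_const + 1)) (divr_gt0 e0 c0)) => v.
rewrite -ball_normE/= ltr_pdivlMr// => uv.
by have := lipschitz_hom u v; have := normr_ge0 (u - v); lra.
Qed.

Lemma subdiff0P p : subdiff J 0 p <-> forall v, dotv p v <= J v.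
Proof.
by split=> h v; have := h v; rewrite subr0 hom0 add0r.
Qed.

(** Test the subgradient inequality at 0 and at [2 u]. *)
Lemma subdiffP u p : subdiff J u p <-> subdiff J 0 p /\ dotv p u = J u.
Proof.
split => [Jp|[/subdiff0P Jp pu] v]; last by rewrite -pu !dotvE addrC subrK.
have e : dotv p u = J u.
  have := Jp 0; have := Jp (2 *: u); rewrite hom0 homZ// !dotvE dotv0; lra.
by split=> //; apply/subdiff0P => v; have := Jp v; rewrite !dotvE; lra.
Qed.

Lemma subdiffZ c u : 0 < c -> subdiff J (c *: u) = subdiff J u.
Proof.
move=> c0; have Jcu : J (c *: u) = c * J u by rewrite homZ// ltW.
apply/seteqP; split=> p /subdiffP[p0 pu]; apply/subdiffP; split=> //; move: pu.
  by rewrite Jcu dotvZr => /(mulfI (lt0r_neq0 c0)).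
by rewrite Jcu dotvZr => ->.
Qed.

Lemma dotv_subdiff_le u p v : subdiff J u p -> `|dotv p v| <= lip_const * `|v|.
Proof.
move=> /subdiffP[/subdiff0P Jp _]; rewrite ler_norml; apply/andP; split.
  have := Jp (- v); rewrite dotvNr homN; have := le_lip_const v; lra.
exact: le_trans (Jp v) (le_lip_const v).
Qed.

Lemma subdiff_bounded u p : subdiff J u p -> `|p| <= lip_const.
Proof.
move=> Jp; apply: norm_le => [|i]; first exact: lip_const_ge0.
have pE : dotv p (delta_mx ord0 i) = p ord0 i.
  rewrite /dotv (bigD1 i)//= mxE !eqxx mulr1 big1 ?addr0// => j ji.
  by rewrite mxE (negbTE ji) andbF mulr0.
rewrite -pE (le_trans (dotv_subdiff_le _ Jp))//.
rewrite -[leRHS]mulr1 ler_wpM2l ?lip_const_ge0//.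
by apply: norm_le => // j; rewrite mxE; case: (_ && _); rewrite ?normr1 ?normr0.
Qed.

Lemma subdiff_convexl u v p c : 0 <= c <= 1 ->
  subdiff J u p -> subdiff J v p -> subdiff J (c *: u + (1 - c) *: v) p.
Proof.
move=> /andP[c0 c1] /subdiffP[p0 pu] /subdiffP[_ pv]; apply/subdiffP; split=> //.
apply/eqP; rewrite eq_le (subdiff0P p).1//=.
rewrite (le_trans (subadditive _ _))// !homZ ?subr_ge0//.
by rewrite !dotvE pu pv.
Qed.

Lemma subdiff_convexr u p q c : 0 <= c <= 1 ->
  subdiff J u p -> subdiff J u q -> subdiff J u (c *: p + (1 - c) *: q).
Proof.
move=> /andP[c0 c1] Jp Jq v; have := Jp v; have := Jq v.
rewrite -!lerBrDl => hq hp.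
have := lerD (ler_wpM2l c0 hp) (ler_wpM2l (_ : 0 <= 1 - c) hq).
rewrite subr_ge0 !dotvE => /(_ c1); lra.
Qed.

Lemma closed_subdiffl p : closed [set u | subdiff J u p].
Proof.
rewrite (_ : mkset _ = \bigcap_v
   [set u : 'rV[R]_n | J u - dotv u p <= J v - dotv p v]).
  apply: closed_bigI => v _.
  apply: (@closed_sublevel R 'rV[R]_n (fun u => J u - dotv u p)) => x.
  exact: (@continuousB R R _ J (fun u => dotv u p) x (@continuous_hom x)
    (@dotvr_continuous _ _ p x)).
apply/seteqP; split => u Jp v => [_|]; have := Jp v => /=;
  rewrite !dotvE (dotvC u); last move=> /(_ I); lra.
Qed.

(** The minimizer of the strongly convex energy [|z - w|^2 / 2 + J z] exists by
coercivity and continuity; twice this energy is used below. *)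
Lemma subdiff_prox w : exists z, subdiff J z (w - z).
Proof.
pose E z : R := dotv (z - w) (z - w) + 2 * J z.
have cE : continuous E.
  move=> z.
  have c1 : {for z, continuous (fun x : 'rV[R]_n => x - w)}.
    apply: (@continuousB R 'rV[R]_n _ id (cst w)); first exact: cvg_id.
    exact: cst_continuous.
  have c2 : {for z, continuous (fun x : 'rV[R]_n => dotv (x - w) (x - w))}.
    apply: (@continuous_comp _ _ _ (fun x : 'rV[R]_n => x - w)
      (fun x => dotv x x)) => //.
    exact: dotv_continuous.
  have c3 : {for z, continuous (fun x : 'rV[R]_n => 2 * J x)}.
    apply: (@continuousM R _ (cst 2) J); last exact: continuous_hom.
    exact: cst_continuous.
  exact: (@continuousD R R _ (fun x : 'rV[R]_n => dotv (x - w) (x - w))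
    (fun x : 'rV[R]_n => 2 * J x) z c2 c3).
pose K := [set z | E z <= E 0].
have clK : closed K.
  exact: closed_sublevel.
have bK : bounded_set K.
  exists (`|w| + (1 + dotv w w)); split; first exact: num_real.
  move=> M /ltW wM z Kz; apply: le_trans wM; move: Kz.
  rewrite /K /E /= hom0 mulr0 addr0 sub0r dotvNl dotvNr opprK => Ez.
  rewrite -[z](subrK w) addrC; apply: le_trans (ler_normD _ _) _; rewrite lerD2l.
  have ww := dotv_ge0 w.
  apply: norm_le_dotv; first by lra.
  by have := J_ge0 z; nra.
have K0 : K !=set0 by exists 0; exact: lexx.
have [z /set_mem zK zmin] := EVT_min_rV K0
  (bounded_closed_compact bK clK) (continuous_subspaceT cE).
exists z => v.
have zv x : E z <= E x.
  have [|xK] := pselect (K x); first by move=> /mem_set/zmin.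
  have/negP := xK; rewrite /K /= -ltNge => /ltW; exact: le_trans.
rewrite addrC -lerBrDr; apply/ler_addgt0Pr => e e0.
pose D := dotv (v - z) (v - z).
have D0 : 0 <= D := dotv_ge0 _.
(* the minimality of z is tested on the segment towards v *)
pose c := Num.min 1 (e / (D + 1)).
have c0 : 0 < c by rewrite lt_min ltr01 divr_gt0//; lra.
have c1 : c <= 1 by rewrite ge_min lexx.
have cD : c * D <= e.
  have : c <= e / (D + 1) by rewrite ge_min lexx orbT.
  by rewrite ler_pdivlMr; nra.
have := zv (c *: v + (1 - c) *: z).
have Jc : J (c *: v + (1 - c) *: z) <= c * J v + (1 - c) * J z.
  by rewrite (le_trans (subadditive _ _))// !homZ ?subr_ge0// ltW.
have -> : E (c *: v + (1 - c) *: z) =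
   dotv (z - w) (z - w) + 2 * c * dotv (z - w) (v - z) + c * (c * D)
   + 2 * J (c *: v + (1 - c) *: z).
  rewrite /E /D; have -> : c *: v + (1 - c) *: z - w = (z - w) + c *: (v - z).
    by apply/rowP => i; rewrite !mxE; ring.
  by move: (z - w) (v - z) => a b; rewrite !dotvE (dotvC b a); ring.
rewrite /E => h.
have : 0 <= c * (2 * dotv (z - w) (v - z) + c * D + 2 * (J v - J z)) by lra.
rewrite pmulr_rge0// -(opprB z w) dotvNl; lra.
Qed.

End OneHomogeneous.

Lemma finite_range (T Y : Type) (K : finType) (key : T -> K) (g : T -> Y) :
  (forall x y, key x = key y -> g x = g y) -> finite_set (range g).
Proof.
move=> keyg; have [x0|noT] := pselect (exists x : T, True); last first.
  rewrite (_ : range g = set0)//; apply/seteqP; split=> // y [x].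
  by case: noT; exists x.
have ex k : exists x, (exists y, key y = k) -> key x = k.
  have [[y yk]|nok] := pselect (exists y, key y = k); first by exists y.
  by have [x _] := x0; exists x.
apply: (@sub_finite_set _ _ ((fun k => g (projT1 (cid (ex k)))) @` setT)).
  move=> y [x _ <-]; exists (key x) => //; apply: keyg.
  by case: cid => z /=; apply; exists x.
exact/finite_image/finite_finset.
Qed.

Lemma convex_hull_sub (R : realType) n (A B : set 'rV[R]_n) :
  (forall p q c, 0 < c < 1 -> B p -> B q -> B (c *: p + (1 - c) *: q)) ->
  A `<=` B -> convex_hull A `<=` B.
Proof.
move=> convB; apply: smallest_sub.
apply/convex_setW => p q /set_mem Bp /set_mem Bq c c0 c1.
by apply/mem_set; apply: convB; rewrite ?c0.
Qed.

Section FiniteFaces.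
Context {R : realType} {n : nat} (J : 'rV[R]_n -> R).
Implicit Types (u v w p q f : 'rV[R]_n).
Context (J_convex : convex_function (setT : set (convex_lmodType 'rV[R]_n)) J).
Context (J_hom : abs_one_homogeneous J).
Context (J_polyhedral : exists2 S : set 'rV[R]_n,
       finite_set S & convex_hull S = subdiff J 0).

(** Let [S] be a finite set that generates the dual ball.  The elements [p] of [S]
with [dotv p u = J u] determine the subdifferential at [u]: a convex combination
of elements of the dual ball attains the maximum [J u] of [dotv _ u] only if its
terms do, so the implication from [dotv p u = J u] to [dotv p v = J v] passes
from [S] to its convex hull. *)
Lemma finite_faces : finite_set (range (subdiff J)).
Proof.
have [S /finite_seqP[s ->] hullS] := J_polyhedral.
have sJ p : p \in s -> forall v, dotv p v <= J v.
  by move=> ps; apply/(subdiff0P J_hom); rewrite -hullS; exact: sub_gen_smallest.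
pose key u := map_tuple (fun p => dotv p u == J u) (in_tuple s).
apply: (@finite_range _ _ _ key).
suff key_sub u v : key u = key v -> subdiff J u `<=` subdiff J v.
  by move=> u v uv; apply/seteqP; split; exact: key_sub.
move=> /(congr1 val)/= /eq_in_map uv.
suff main : subdiff J 0 `<=`
    [set p | subdiff J 0 p /\ (dotv p u = J u -> dotv p v = J v)].
  move=> p /(subdiffP J_hom)[/main[p0 h] /h pv].
  exact/(subdiffP J_hom).
rewrite -{1}hullS; apply: convex_hull_sub => [p q c /andP[c0 c1]|p ps].
  move=> [p0 hp] [q0 hq]; split.
    by apply: subdiff_convexr => //; rewrite (ltW c0) (ltW c1).
  have pu := (subdiff0P J_hom p).1 p0 u; have qu := (subdiff0P J_hom q).1 q0 u.
  rewrite !dotvE => e.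
  by rewrite hp ?hq; [ring|apply/eqP; rewrite eq_le; nra..].
split; first by apply/(subdiff0P J_hom); exact: sJ.
by move=> /eqP; rewrite uv// => /eqP.
Qed.

(** The value at [q] is determined by the subdifferentials that contain [q]. *)
Lemma finite_normal_cones f :
  finite_set (range (fun q => [set a | subdiff J (a + f) q])).
Proof.
have /finite_seqP[F FE] := finite_faces.
pose key q := map_tuple (fun X : set 'rV[R]_n => `[< X q >]) (in_tuple F).
apply: (@finite_range _ _ _ key) => q r /(congr1 val)/= /eq_in_map qr.
apply/funext => a; apply/propext; apply: asbool_eq_equiv.
apply: (qr (subdiff J (a + f))).
by have : range (subdiff J) (subdiff J (a + f)) by []; rewrite FE.
Qed.

End FiniteFaces.

(** * The three methods *)

Lemma backward_step_convex (R : realType) n (f p q : 'rV[R]_n) (c s t : R) :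
  let r := c * s + (1 - c) * t in let e := c * s / r in r != 0 ->
  f - r *: (e *: p + (1 - e) *: q) = c *: (f - s *: p) + (1 - c) *: (f - t *: q).
Proof. by move=> /= r0; apply/rowP => i; rewrite !mxE; field; exact: r0. Qed.

Section Flows.
Context {R : realType} {n : nat} (J : 'rV[R]_n -> R).
Local Notation V := 'rV[R]_n.
Implicit Types (v w p q f : V).
Context (J_ge0 : forall u, 0 <= J u).
Context (J_convex : convex_function (setT : set (convex_lmodType 'rV[R]_n)) J).
Context (J_hom : abs_one_homogeneous J).
Context (J_polyhedral : exists2 S : set 'rV[R]_n,
       finite_set S & convex_hull S = subdiff J 0).

Lemma subdiff_resolvent w t : 0 < t -> exists p, subdiff J (w - t *: p) p.
Proof.
move=> t0; have [z Jz] := subdiff_prox J_convex J_hom J_ge0 (t^-1 *: w).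
exists (t^-1 *: w - z).
rewrite (_ : w - _ = t *: z) ?subdiffZ// scalerBr scalerA divff ?lt0r_neq0//.
by rewrite scale1r opprB addrC subrK.
Qed.

(** The resolvents at [u] are bounded, so those of small step are subgradients at
points where all subgradients are subgradients at [u]. *)
Lemma subdiff_nonempty (u : V) : subdiff J u !=set0.
Proof.
have /nbhs_ballP[d /= d0 dJ] := near_sub_values (finite_faces J_hom J_polyhedral)
  (closed_subdiffl J_convex J_hom J_ge0) u.
have L0 := lip_const_ge0 J_ge0.
pose t := d / (lip_const J + 1).
have t0 : 0 < t by apply: divr_gt0 => //; lra.
have [p Jp] := subdiff_resolvent u t0; exists p; apply: (dJ _ _ _ Jp).
rewrite -ball_normE/= opprB addrC subrK normrZ gtr0_norm// /t.
rewrite mulrAC ltr_pdivrMr; last lra.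
have := subdiff_bounded J_convex J_hom J_ge0 Jp; nra.
Qed.

Theorem gradient_flow_piecewise_linear f : exists (u : R -> V) K t pt,
  piecewise_linear_solution (subdiff J) f u K t pt /\ lipschitz_halfline u.
Proof.
apply: exists_piecewise_linear_solution.
- by move=> x y a b; exact: subdiff_monotone.
- exact: subdiff_resolvent.
- exact: finite_faces.
- exact: closed_subdiffl.
- by move=> a x y c; exact: subdiff_convexl.
- exact: subdiff_nonempty.
Qed.

(** The inverse scale space flow reads [q' \in - scale_space_operator f q]. *)
Definition scale_space_operator f q : set V := [set a | subdiff J (a + f) q].

Lemma scale_space_operator_monotone f q r a b :
  scale_space_operator f q a -> scale_space_operator f r b -> 0 <= dotv (a - b) (q - r).
Proof.
move=> qa rb; have := subdiff_monotone qa rb.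
by rewrite dotvC opprD addrACA subrr addr0.
Qed.

Theorem inverse_scale_space_piecewise_linear f : exists (q : R -> V) K t pt,
  piecewise_linear_solution (scale_space_operator f) 0 q K t pt /\ lipschitz_halfline q.
Proof.
apply: exists_piecewise_linear_solution.
- exact: scale_space_operator_monotone.
- move=> q t t0; have [z Jz] := subdiff_prox J_convex J_hom J_ge0 (q + t *: f).
  exists (t^-1 *: z - f); rewrite /scale_space_operator /= subrK subdiffZ ?invr_gt0//.
  rewrite scalerBr scalerA divff ?lt0r_neq0// scale1r opprB addrA.
  by rewrite [q + _ - _](_ : _ = q + t *: f - z).
- exact: finite_normal_cones.
- by move=> a; exact: closed_subdiff.
- by move=> a x y c; exact: subdiff_convexr.
- by exists (- f); rewrite /scale_space_operator /= addNr; apply/subdiff0P => // v; rewrite dot0v.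
Qed.

Lemma inverse_scale_spaceP f (q v : R -> V) : inverse_scale_space_flow J f q v <->
  evolution (scale_space_operator f) 0 q (fun s => v s - f).
Proof.
have E (s : R) : f - v s = - (v s - f) by rewrite opprB.
have E' (s : R) : subdiff J (v s) (q s) = scale_space_operator f (q s) (v s - f).
  by rewrite /scale_space_operator/= subrK.
by split=> -[acq q0 aeq]; split=> //; move: aeq;
  apply: (@filterS _ _ (ae_filter_ringOfSetsType _)) => s + s0 => /(_ s0);
  rewrite E E'.
Qed.

Section Variational.
Context (f : V).
Context (p : R -> V) (pP : forall t, 0 < t -> subdiff J (f - t *: p t) (p t)).
Local Notation u := (fun t => f - t *: p t).

(** Two solutions [p], [q] satisfy [0 <= dotv (q - p) (- t (q - p))]. *)
Lemma resolvent_unique t q : 0 < t -> subdiff J (f - t *: q) q -> q = p t.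
Proof.
move=> t0 Jq; have := subdiff_monotone Jq (pP t0).
rewrite (_ : f - t *: q - _ = - (t *: (q - p t))); last first.
  by apply/rowP => i; rewrite !mxE; ring.
rewrite dotvNr dotvZr -mulrN pmulr_rge0// oppr_ge0 => /dotv_le0/eqP.
by rewrite subr_eq0 => /eqP.
Qed.

Lemma variational_method_resolvent : variational_method J f u.
Proof.
split=> [|t t0]; first by rewrite scale0r subr0.
set ut := f - t *: p t.
have gap v : 2^-1 * enorm (ut - f) ^+ 2 + t * J ut + 2^-1 * dotv (v - ut) (v - ut)
    <= 2^-1 * enorm (v - f) ^+ 2 + t * J v.
  have := ler_wpM2l (ltW t0) (pP t0 v); rewrite -/ut !enorm_sqr.
  rewrite (_ : v - f = (v - ut) - t *: p t); last first.
    by apply/rowP => i; rewrite !mxE; ring.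
  rewrite (_ : ut - f = - (t *: p t)); last first.
    by apply/rowP => i; rewrite !mxE; ring.
  by move: (v - ut) => d; rewrite !dotvE (dotvC d (p t)); lra.
apply/seteqP; split=> [v vmin|_ -> v] /=.
  apply/eqP; rewrite -subr_eq0; apply/eqP/dotv_le0.
  have := gap v; have := vmin ut; lra.
by have := gap v; have := dotv_ge0 (v - ut); lra.
Qed.

Lemma pVM_resolvent t : 0 < t -> pVM f u t = p t.
Proof.
move=> t0; rewrite /pVM opprB addrC subrK scalerA mulVf ?lt0r_neq0//.
by rewrite scale1r.
Qed.

(** With [d = u s - u t], monotonicity removes one of the two terms of
[d = - s (p s - p t) - (s - t) p t] from [dotv d d].  For [s = 0] this term
vanishes, whatever [p 0] is. *)
Lemma lipschitz_resolvent : lipschitz_halfline u.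
Proof.
have L0 := lip_const_ge0 J_ge0.
exists (lip_const J) => // s t s0 t0.
have main (r1 r2 : R) : 0 <= r1 -> 0 < r2 -> `|u r1 - u r2| <= lip_const J * `|r1 - r2|.
  move=> r10 r20; set d := u r1 - u r2.
  have dE : d = - (r1 *: (p r1 - p r2)) - (r1 - r2) *: p r2.
    by apply/rowP => i; rewrite !mxE; ring.
  have h1 : 0 <= r1 * dotv (p r1 - p r2) d.
    move: r10; rewrite le_eqVlt => /predU1P[<-|r10]; first by rewrite mul0r.
    by rewrite mulr_ge0 ?(ltW r10)//; exact: subdiff_monotone (pP r10) (pP r20).
  have h2 : dotv d d <= `|r1 - r2| * (lip_const J * `|d|).
    rewrite {1}dE dotvDl !dotvNl !dotvZl.
    have := dotv_subdiff_le J_convex J_hom J_ge0 d (pP r20) => h.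
    have : - ((r1 - r2) * dotv (p r2) d) <= `|r1 - r2| * (lip_const J * `|d|).
      apply: le_trans (ler_norm _) _; rewrite normrN normrM.
      exact: ler_wpM2l.
    lra.
  have h3 := norm_sqr_le_dotv d.
  have [->|d0] := eqVneq d 0; first by rewrite normr0 mulr_ge0.
  have nd : 0 < `|d| by rewrite normr_gt0.
  rewrite -(ler_pM2r nd) -expr2; lra.
move: t0; rewrite le_eqVlt => /predU1P[<-|t0]; last exact: main.
move: s0; rewrite le_eqVlt => /predU1P[<-|s0]; first by rewrite !subrr !normr0 mulr0.
by rewrite distrC (distrC s); exact: main.
Qed.

(** Both conditions pass to convex combinations, and every positive time belongs
to this set when [X] is the subdifferential at [u t]. *)
Definition face_times (X : set V) : set R :=
  [set t | [/\ 0 < t, X (p t) & X `<=` subdiff J (f - t *: p t)]].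

(** A convex combination of [u s] and [u t] is [f - r q] with [r] the combined time
and [q] a convex combination of [p s] and [p t], with other weights.  Here [q] is
in [X], which is included in the subdifferential at the combined point, so [q] is
[p r]. *)
Lemma face_times_convex X : range (subdiff J) X -> affine_on_convex (face_times X) u.
Proof.
move=> [v0 _ XE] s t c [s0 Xs sX] [t0 Xt tX] c01; have /andP[c0 c1] := c01.
set r := c * s + (1 - c) * t.
have r0 : 0 < r.
  rewrite /r; have [->|c0'] := eqVneq c 0; first by lra.
  by rewrite ltr_wpDr ?mulr_ge0 ?subr_ge0 ?(ltW t0)// mulr_gt0// lt_neqAle eq_sym c0'.
pose e := c * s / r.
have e01 : 0 <= e <= 1.
  rewrite /e divr_ge0 ?mulr_ge0 ?(ltW s0) ?(ltW r0)//= ler_pdivrMr// mul1r /r.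
  by rewrite lerDl mulr_ge0 ?subr_ge0 ?(ltW t0).
pose q := e *: p s + (1 - e) *: p t.
have ur : f - r *: q = c *: u s + (1 - c) *: u t.
  by apply: backward_step_convex; exact: lt0r_neq0.
have Xq : X q by rewrite -XE; apply: subdiff_convexr => //; rewrite XE.
have Xr : X `<=` subdiff J (f - r *: q).
  by move=> x Xx; rewrite ur; apply: subdiff_convexl => //; [exact: sX|exact: tX].
have pr : q = p r by apply: resolvent_unique => //; exact: Xr.
by rewrite -/r -pr -ur; split=> //; split; rewrite // -pr.
Qed.

Lemma variational_piecewise_affine : exists K t, breakpoints K t /\
  forall i, (i < K)%N -> affine_on (between (t i) (t i.+1)) u.
Proof.
have /finite_seqP[F FE] := finite_faces J_hom J_polyhedral.
have FP X : X \in F <-> range (subdiff J) X by rewrite FE.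
apply: (finite_affine_pieces (Is := map face_times F) lipschitz_resolvent).
  by move=> _ /mapP[X /FP XF ->]; exact: face_times_convex.
move=> t t0; exists (face_times (subdiff J (u t))).
  by apply: map_f; apply/FP; exists (u t).
by split=> //; exact: pP.
Qed.

End Variational.

Lemma between_inv (a b : \bar R) (s : R) : (0 <= a)%E -> (a < b)%E -> 0 < s ->
  between b^-1%E a^-1%E s -> between a b s^-1.
Proof.
move=> a0 ab s0 [bs sa]; split.
  have af : a \is a fin_num by rewrite ge0_fin_numE// (lt_le_trans ab)// leey.
  move: sa a0; rewrite -(fineK af) inver; move: (fine a) => x.
  case: eqP => [-> _ _|/eqP x_neq0]; first by rewrite lee_fin invr_ge0 (ltW s0).
  rewrite !lee_fin => sx x_ge0.
  have x0 : 0 < x by rewrite lt_neqAle eq_sym x_neq0.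
  by rewrite -[x]invrK lef_pV2 ?posrE ?invr_gt0.
have [->|bf] := eqVneq b +oo%E; first by rewrite leey.
have {}bf : b \is a fin_num.
  by rewrite ge0_fin_numE ?(le_trans a0 (ltW ab))// lt_neqAle bf leey.
move: bs ab; rewrite -(fineK bf); move: (fine b) => y + ay.
have y0 : 0 < y by rewrite -lte_fin (le_lt_trans a0).
rewrite inver gt_eqF// !lee_fin => ys.
by rewrite -[y]invrK lef_pV2 ?posrE ?invr_gt0.
Qed.

Lemma affine_on_qVM f (u : R -> V) (a b : \bar R) : (0 <= a)%E -> (a < b)%E ->
  affine_on (between a b) u ->
  affine_on (between b^-1%E a^-1%E `&` [set s : R | 0 < s]) (qVM f u).
Proof.
move=> a0 ab [c [d ucd]]; exists (- d), (f - c) => s [sab /= s0].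
rewrite /qVM /pVM invrK (ucd _ (between_inv a0 ab s0 sab)).
apply/rowP => i; rewrite !mxE; field; exact: lt0r_neq0.
Qed.

End Flows.

Theorem theorem4 (R : realType) (n : nat) (J : 'rV[R]_n -> R)
    (J_ge0 : forall u, 0 <= J u)
    (J_convex : convex_function (setT : set (convex_lmodType 'rV[R]_n)) J)
    (J_lsc : lower_semicontinuous (fun u : 'rV[R]_n => (J u)%:E))
    (J_hom : abs_one_homogeneous J)
    (J_polyhedral : exists2 S : set 'rV[R]_n,
       finite_set S & convex_hull S = subdiff J 0)
    (f : 'rV[R]_n) :
  [/\
    exists u p : R -> 'rV[R]_n,
    [/\ gradient_flow J f u p,
        forall u' p', gradient_flow J f u' p' ->
          eq_on_halfline u' u /\ ae_eq_on_halfline p' p &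
        exists (K : nat) (t : nat -> \bar R) (pt : nat -> 'rV[R]_n),
          breakpoints K t /\
          forall i : nat, (i < K)%N ->
            (forall tau : R, between (t i) (t i.+1) tau ->
               u tau = u (fine (t i)) - (tau - fine (t i)) *: pt i.+1 /\
               subdiff J (u tau) (pt i.+1)) /\
            {ae lebesgue_measure, forall tau : R,
               between (t i) (t i.+1) tau -> p tau = pt i.+1}],

    exists q v : R -> 'rV[R]_n,
    [/\ inverse_scale_space_flow J f q v,
        forall q' v', inverse_scale_space_flow J f q' v' ->
          eq_on_halfline q' q /\ ae_eq_on_halfline v' v &
        exists (L : nat) (s : nat -> \bar R) (vs : nat -> 'rV[R]_n),
          breakpoints L s /\
          forall i : nat, (i < L)%N ->
            (forall sigma : R, between (s i) (s i.+1) sigma ->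
               q sigma = q (fine (s i)) +
                         (sigma - fine (s i)) *: (f - vs i.+1) /\
               subdiff J (vs i.+1) (q sigma)) /\
            {ae lebesgue_measure, forall sigma : R,
               between (s i) (s i.+1) sigma -> v sigma = vs i.+1}] &

    exists u : R -> 'rV[R]_n,
    [/\ variational_method J f u,
        forall t : R, 0 < t -> subdiff J (u t) (pVM f u t) &
        exists (L : nat) (t : nat -> \bar R),
          breakpoints L t /\
          forall i : nat, (i < L)%N ->
            affine_on (between (t i) (t i.+1)) u /\
            affine_on
              (between (t i.+1)^-1%E (t i)^-1%E `&` [set s : R | 0 < s])
              (qVM f u)]
  ].
Proof.
split.
- have [u [K [t [pt [ut uc]]]]] :=
    gradient_flow_piecewise_linear J_ge0 J_convex J_hom J_polyhedral f.
  have uev := piecewise_linear_evolution ut uc.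
  exists u, (fun s => - 'D_1 u s); split => //.
    move=> u' p' u'p'; apply: (evolution_unique _ uev u'p').
    by move=> x y a b; exact: subdiff_monotone.
  have [_ bt uA] := ut; exists K, t, pt; split=> // i iK; split.
    exact: uA.
  exact: piecewise_linear_velocity ut iK.
- have [q [K [t [pt [qt qc]]]]] :=
    inverse_scale_space_piecewise_linear J_ge0 J_convex J_hom J_polyhedral f.
  have qev := piecewise_linear_evolution qt qc.
  exists q, (fun s => - 'D_1 q s + f); split => //.
  + apply/inverse_scale_spaceP; move: qev; congr evolution.
    by apply/funext => s; rewrite addrK.
  + move=> q' v' /inverse_scale_spaceP q'v'.
    have [qq' vv'] := evolution_unique (@scale_space_operator_monotone _ _ J f) qev q'v'.
    split=> //; move: vv'; apply: (@filterS _ _ (ae_filter_ringOfSetsType _)).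
    by move=> s + s0 => /(_ s0) <-; rewrite subrK.
  have [_ bt qA] := qt; exists K, t, (fun i => pt i + f); split=> // i iK; split.
    move=> s /(qA i iK)[-> Jq]; split=> //.
    by rewrite opprD addrCA subrr addr0 scalerN.
  have := piecewise_linear_velocity qt iK.
  apply: (@filterS _ _ (ae_filter_ringOfSetsType _)) => s + sb => /(_ sb) ->.
  by [].
- have ex t : exists p, 0 < t -> subdiff J (f - t *: p) p.
    have [t0|t0] := ltP 0 t; last by exists 0.
    by have [p ?] := subdiff_resolvent J_ge0 J_convex J_hom f t0; exists p.
  pose p t := projT1 (cid (ex t)).
  have pP t : 0 < t -> subdiff J (f - t *: p t) (p t) by rewrite /p; case: cid.
  exists (fun t => f - t *: p t); split.
  + exact: variational_method_resolvent.
  + by move=> t t0; rewrite pVM_resolvent//; exact: pP.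
  + have [K [t [bt ta]]] := variational_piecewise_affine J_ge0 J_convex J_hom J_polyhedral pP.
    exists K, t; split=> // i iK; split; first exact: ta.
    apply: affine_on_qVM (ta i iK); first exact: breakpoints_ge0 bt (ltnW iK).
    by have [_ _] := bt; apply.
Qed.
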